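(* Let $\nu$ be a Borel probability measure on $\mathbb{P}^n=\mathbb{P}^n(\mathbb{C})$. Then $\nu$ is polystable (with respect to the standard action of $\mathrm{SL}(n+1,\mathbb{C})$) if and only if there exist a splitting $\mathbb{C}^{n+1}=V_0\oplus\cdots\oplus V_r$ and Borel probability measures $\nu_j\in\mathscr{P}(\mathbb{P}(V_j))$ such that $\nu_j$ is stable with respect to $\mathrm{SL}(V_j,\mathbb{C})$ for $j=0,\ldots,r$ and $$\nu=\sum_{j=0}^r\frac{\dim V_j}{n+1}\,\nu_j .$$
   Context: For a finite-dimensional complex vector space $V\neq 0$, fix a Hermitian product $h$ on $V$. The group $K=\mathrm{SU}(V,h)$, with complexification $G=\mathrm{SL}(V,\mathbb{C})$, acts on $\mathbb{P}(V)$ with momentum mapping (identifying $\mathfrak{su}(V,h)^*\cong\mathfrak{su}(V,h)$ by an invariant scalar product $\langle A,B\rangle=-\operatorname{tr}(AB)$) $\mu([z])=-i\big(P_z-\frac{\mathrm{id}_V}{\dim V}\big)$, where $P_z$ is the $h$-orthogonal projection onto $\mathbb{C}z$. $\mathscr{P}(\mathbb{P}(V))$ is the set of Borel probability measures on $\mathbb{P}(V)$; $G$ acts on it by push-forward $g\cdot\nu=g_*\nu$. Let $\mathfrak{F}(\nu)=\int_{\mathbb{P}(V)}\mu\,d\nu$, let $G_\nu$ be the stabilizer of $\nu$ and $\mathfrak{g}_\nu$ its Lie algebra. $\nu$ is polystable with respect to $\mathrm{SL}(V,\mathbb{C})$ if there is $g\in G$ with $\mathfrak{F}(g\cdot\nu)=0$;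 it is stable if it is polystable and $\mathfrak{g}_\nu$ is conjugate (under $\operatorname{Ad}(G)$) to a subalgebra of $\mathfrak{su}(V,h)$. These notions do not depend on the choice of $h$. In the theorem, $\mathbb{P}^n=\mathbb{P}(\mathbb{C}^{n+1})$ with the standard Hermitian product; the $V_j$ are nonzero linear subspaces ($r\ge 0$), not necessarily orthogonal to each other, and a measure on $\mathbb{P}(V_j)$ is regarded as a measure on $\mathbb{P}^n$ via the inclusion $\mathbb{P}(V_j)\subset\mathbb{P}^n$. *)

(* Defs.v *)
From HB Require Import structures.
From mathcomp Require Import all_boot all_order all_algebra.
From mathcomp Require Import all_classical all_reals all_analysis.
From mathcomp Require Import complex.

Set Implicit Arguments.
Unset Strict Implicit.
Unset Printing Implicit Defensive.

Import Order.TTheory GRing.Theory Num.Theory.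
Import numFieldNormedType.Exports.
Import passmx.

Local Open Scope classical_set_scope.
Local Open Scope ring_scope.

(* numFieldNormedType gives numFieldTypes their topology; the same for R[i]. *)
HB.instance Definition _ (R : realType) :=
  NormedModule.copy R[i] (R[i] : numFieldType)^o.

(* The lines of V.  A measurableType has to be inhabited, so when V = 0 (a     *)
(* case excluded wherever proj is used) proj V is the one-point type {0}.      *)
Definition proj (R : realType) (V : vectType R[i]) :=
  {L : {vspace V} | \dim L == minn 1 (\dim {:V})}.

Section ProjectiveSpace.
Context (R : realType) (V : vectType R[i]).

HB.instance Definition _ := SubChoice.on (proj V).

Fact proj_point_subproof :
  \dim (<[vpick {:V}]>%VS) == minn 1 (\dim {:V}).
Proof.
rewrite dim_vline vpick0 -dimv_eq0.
by case: (\dim {:V}) => [//|k]; rewrite /minn; case: k.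
Qed.

HB.instance Definition _ :=
  isPointed.Build (proj V) (Sub <[vpick {:V}]>%VS proj_point_subproof).

Local Notation e := (vbasis {:V}).

(* [v]; only meaningful for v != 0. *)
Definition pline (v : V) : proj V := insubd (point : proj V) <[v]>%VS.

(* The quotient topology of V \ {0} -> P(V), V being topologized by the         *)
(* coordinates in a basis.                                                     *)
Definition proj_open (U : set (proj V)) :=
  open [set x : 'rV[R[i]]_(\dim {:V}) | x != 0 /\ U (pline (vecof e x))].

Fact proj_openT : proj_open setT.
Proof.
rewrite /proj_open.
set A := (X in open X).
have -> : A = \bigcup_i (fun x => x 0 i) @^-1` ~` [set 0 : R[i]].
  apply/seteqP; split=> x /=.
    by move=> [/rV0Pn[i xi] _]; exists i => //=; exact/eqP.
  move=> [i _ /= xi]; split=> //; apply/rV0Pn.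
  by exists i; exact/eqP.
apply: bigcup_open => i _; apply: open_comp.
  by move=> x _; exact: coord_continuous.
apply: closed_openC; apply: accessible_closed_set1.
by apply: hausdorff_accessible; exact: norm_hausdorff.
Qed.

Fact proj_openI (A B : set (proj V)) :
  proj_open A -> proj_open B -> proj_open (A `&` B).
Proof.
move=> oA oB; rewrite /proj_open.
set C := (X in open X).
have -> : C = [set x | x != 0 /\ A (pline (vecof e x))] `&`
              [set x | x != 0 /\ B (pline (vecof e x))].
  by apply/seteqP; split=> x /=; [move=> [? [? ?]]|move=> [[? ?] [? ?]]].
exact: openI.
Qed.

Fact proj_open_bigU (I : Type) (f : I -> set (proj V)) :
  (forall i, proj_open (f i)) -> proj_open (\bigcup_i f i).
Proof.
move=> of_; rewrite /proj_open.
set C := (X in open X).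
have -> : C = \bigcup_i [set x | x != 0 /\ f i (pline (vecof e x))].
  apply/seteqP; split=> x /=; first by move=> [x0 [i _ fi]]; exists i.
  by move=> [i _ /= [x0 fi]]; split=> //; exists i.
by apply: bigcup_open => i _; exact: of_.
Qed.

HB.instance Definition _ :=
  isOpenTopological.Build (proj V) proj_openT proj_openI proj_open_bigU.

End ProjectiveSpace.

(* P(V) with its Borel sigma-algebra. *)
Notation projB V := (g_sigma_algebraType (@open (proj V))).

Section ProjectiveMaps.
Context (R : realType).
Implicit Types V W : vectType R[i].

(* The map [v] |-> [f v] induced by an injective f. *)
Definition projmap V W (f : 'Hom(V, W)) (L : proj V) : proj W :=
  insubd (point : proj W) (f @: val L)%VS.

Lemma val_pline V (v : V) : v != 0 -> val (pline v) = <[v]>%VS.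
Proof.
move=> v0; apply: insubdK; rewrite /in_mem/= dim_vline v0.
apply/eqP/esym/minn_idPl; rewrite lt0n dimv_eq0.
by apply: contraNneq v0 => V0; have := memvf v; rewrite V0 memv0.
Qed.

Lemma projmap_pline V W (f : 'Hom(V, W)) (v : V) :
  v != 0 -> projmap f (pline v) = pline (f v).
Proof.
by move=> v0; rewrite /projmap val_pline// limg_line.
Qed.

Lemma mulmxr_continuous m n (M : 'M[R[i]]_(m, n)) :
  continuous (fun x : 'rV[R[i]]_m => x *m M).
Proof.
move=> x A [/= P Px PA].
have H : nbhs x [set y : 'rV_m | forall j, P ord0 j ((y *m M) ord0 j)].
  apply: (@filter_forall _ _
    (fun j (y : 'rV_m) => P ord0 j ((y *m M) ord0 j)) (nbhs x)) => j.
  have : continuous (fun y : 'rV[R[i]]_m => (y *m M) ord0 j).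
    under eq_fun do rewrite mxE.
    apply: (continuous_big add_continuous) => k _ y.
    apply: (@cvgM _ _ (nbhs y)); last exact: cvg_cst.
    exact: coord_continuous.
  by apply; exact: Px.
apply: filterS H => y /= Py; apply: PA => i j; rewrite ord1; exact: Py.
Qed.

Lemma projmap_continuous V W (f : 'Hom(V, W)) :
  lker f == 0%VS -> continuous (projmap f).
Proof.
move=> f0; apply/continuousP => U; rewrite /open/= /proj_open => oU.
have eV : basis_of {:V} (vbasis {:V}) by exact: vbasisP.
have eW : basis_of {:W} (vbasis {:W}) by exact: vbasisP.
have := open_comp (fun x _ => @mulmxr_continuous _ _
  (mxof (vbasis {:V}) (vbasis {:W}) f) x) oU.
congr open; apply/seteqP; split => x /=.
  rewrite mul_mxof -(rVofK eW (f _)) !vecofK// rVof_eq0// => -[fx0 Ux].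
  have x0 : vecof (vbasis {:V}) x != 0.
    by apply: contraNneq fx0 => ->; rewrite linear0.
  by rewrite -(vecof_eq0 eV) x0 projmap_pline// -(rVofK eW (f _)).
rewrite -(vecof_eq0 eV) mul_mxof rVof_eq0// rVofK// => -[x0].
rewrite projmap_pline// => Ux; split=> //.
by apply: contra x0 => /eqP fx0; apply/eqP/(lker0P f0); rewrite fx0 linear0.
Qed.

Lemma measurable_projmap V W (f : 'Hom(V, W)) : lker f == 0%VS ->
  measurable_fun [set: projB V] (projmap f : projB V -> projB W).
Proof.
move=> f0; apply: (@measurability _ _ (projB V) (projB W) setT (projmap f)
  (@open (proj W)) erefl).
move=> _ [U oU <-]; rewrite setTI; apply: sub_sigma_algebra.
by have /continuousP/(_ U oU) := projmap_continuous f0.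
Qed.

End ProjectiveMaps.

Section Stability.
Context (R : realType) (V : vectType R[i]).
Local Notation e := (vbasis {:V}).

(* The matrix of g is taken in the basis e, but its determinant (and below its *)
(* trace) does not depend on this choice.                                      *)
Definition SL := {g : 'End(V) | \det (mxof e e g) == 1}.

Lemma lker_SL (g : SL) : lker (val g) == 0%VS.
Proof.
apply/lker0P => u v guv; have eV : basis_of {:V} e by exact: vbasisP.
have Mu : mxof e e (val g) \in unitmx by rewrite unitmxE (eqP (valP g)) unitr1.
apply: (can_inj (rVofK eV)); apply: (can_inj (mulmxK Mu)).
by rewrite !mul_mxof !rVofK// guv.
Qed.

Definition SL_act (g : SL) : projB V -> projB V := projmap (val g).

HB.instance Definition _ (g : SL) :=
  isMeasurableFun.Build _ _ _ _ (SL_act g) (measurable_projmap (lker_SL g)).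

(* g . nu = g_* nu *)
Definition SL_push (g : SL) (nu : probability (projB V) R) :
  probability (projB V) R := distribution nu (SL_act g).

Definition SL_stab (nu : probability (projB V) R) : set SL :=
  [set g | forall A, measurable A -> SL_push g nu A = nu A].

Definition expEnd (A : 'End(V)) : 'End(V) :=
  hommx e e (limn (series (fun k => (k`!%:R : R[i])^-1 *: mxof e e A ^+ k))).

(* The Lie algebra of the closed subgroup G_nu = SL_stab nu of SL(V), as the    *)
(* set of A with exp(tA) in G_nu for all real t.                               *)
Definition lie_stab (nu : probability (projB V) R) : set 'End(V) :=
  [set A | forall t : R,
    exists2 g, SL_stab nu g & val g = expEnd ((t%:C)%C *: A)].

Definition Ad (g : SL) (A : 'End(V)) : 'End(V) :=
  (val g \o A \o (val g)^-1)%VF.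

End Stability.

(* The integral of a V-valued function, computed coordinatewise. *)
Definition vintegral d (T : measurableType d) (R : realType)
    (V : vectType R[i]) (nu : {measure set T -> \bar R}) (f : T -> V) : V :=
  let e := vbasis {:V} in
  \sum_(k < \dim {:V})
    Complex (\int[nu]_x complex.Re (coord e k (f x)))
            (\int[nu]_x complex.Im (coord e k (f x))) *: e`_k.

Section Hermitian.
Context (R : realType) (V : vectType R[i]) (h : {dot V for Num.conj}).
Local Notation e := (vbasis {:V}).

Definition su : set 'End(V) :=
  [set A : 'End(V) |
    (forall u v, h (A u) v = - h u (A v)) /\ \tr (mxof e e A) = 0].

(* Orthogonal projection onto the line spanned by z != 0. *)
Definition line_proj (z : V) : 'End(V) :=
  linfun (fun v => (h v z / h z z) *: z).

Lemma line_projE z v : line_proj z v = (h v z / h z z) *: z.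
Proof.
have lin : linear (fun v => (h v z / h z z) *: z).
  by move=> a u w; rewrite linearPl/= mulrDl -mulrA scalerDl scalerA.
pose L := GRing.isLinear.Build _ _ _ _ _ lin.
pose F : {linear V -> V} := HB.pack (fun v => (h v z / h z z) *: z) L.
by rewrite /line_proj -/(F : V -> V) lfunE.
Qed.

Definition momentum (L : proj V) : 'End(V) :=
  - ('i *: (line_proj (vpick (val L)) - (\dim {:V})%:R^-1 *: \1%VF)).

Definition frakF (nu : probability (projB V) R) : 'End(V) :=
  vintegral nu momentum.

Definition polystable (nu : probability (projB V) R) : Prop :=
  exists g : SL V, frakF (SL_push g nu) = 0.

(* Since lie_stab nu is a Lie algebra, its conjugate is a subalgebra of su as   *)
(* soon as it is contained in su.                                              *)
Definition stable (nu : probability (projB V) R) : Prop :=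
  polystable nu /\ exists g : SL V, Ad g @` lie_stab nu `<=` su.

End Hermitian.

Section Subspace.
Context (R : realType) (V : vectType R[i]) (U : {vspace V}).

(* The inclusion P(U) -> P(V). *)
Definition proj_incl : projB (subvs_of U) -> projB V :=
  projmap (linfun (vsval : subvs_of U -> V)).

Fact lker_vsval : lker (linfun (vsval : subvs_of U -> V)) == 0%VS.
Proof. by apply/lker0P => u v; rewrite !lfunE => /val_inj. Qed.

HB.instance Definition _ :=
  isMeasurableFun.Build _ _ _ _ proj_incl (measurable_projmap lker_vsval).

Definition dot_restr (h : {dot V for Num.conj}) (u v : subvs_of U) : R[i] :=
  h (vsval u) (vsval v).

Section DotRestr.
Variable h : {dot V for Num.conj}.

Fact dot_restr_bilinear :
  bilinear_for *%R (Num.conj \; *%R) (dot_restr h).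
Proof.
by split=> u a v w; rewrite /dot_restr linearP ?linearPl ?linearPr.
Qed.

HB.instance Definition _ :=
  bilinear_isBilinear.Build _ _ _ _ _ _ (dot_restr h) dot_restr_bilinear.

Fact dot_restr_herm u v :
  dot_restr h u v = (-1) ^+ false * Num.conj (dot_restr h v u).
Proof. exact: hermC. Qed.

HB.instance Definition _ :=
  isHermitianSesquilinear.Build _ _ _ _ (dot_restr h) dot_restr_herm.

Fact dot_restr_gt0 u : u != 0 -> 0 < dot_restr h u u.
Proof.
move=> u0; apply: neq0_dnorm_gt0.
by apply: contraNneq u0 => vu0; apply/eqP/val_inj.
Qed.

HB.instance Definition _ :=
  isDotProduct.Build _ _ (dot_restr h) dot_restr_gt0.

End DotRestr.
End Subspace.

(* Main.v *)
Require Import Defs.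
From mathcomp Require Import all_boot all_order all_algebra.
From mathcomp Require Import all_classical all_reals all_analysis.
From mathcomp Require Import measurable_realfun complex ring.
From HB Require Import structures.
Import Order.TTheory GRing.Theory Num.Theory.
Import numFieldNormedType.Exports.
Import passmx.
Local Open Scope classical_set_scope.
Local Open Scope ring_scope.

(** Call nu isotropic for a Hermitian product h' on V when the average over nu of
    the h'-orthogonal projections onto the lines of V is the identity divided by
    dim V. The vanishing of the momentum integral of g . nu says that nu is
    isotropic for the pull-back of h along g, and every Hermitian product is such
    a pull-back up to a factor; so nu is polystable if and only if it is isotropic
    for some Hermitian product ([polystable_isotropic]).

    In one direction, let V be the direct sum of the V_j and let nu_j be isotropic
    for h_j. Then the mixture of the nu_j with weights dim V_j / dim V is isotropic
    for the orthogonal sum of the h_j ([glue_isotropic]): the Rayleigh quotient of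
    B at a line of V_j is that of the j-th diagonal block of B, and the weights
    turn the average into the trace of B.

    In the other direction, let nu be isotropic for h'. Split V repeatedly into
    direct sums of subspaces on whose projective spaces nu is carried, until no
    piece splits any further ([irreducible_splitting]). Testing isotropy on
    endomorphisms of one piece shows that its mass is dim V_j / dim V and that the
    normalized restriction nu_j is isotropic ([split_isotropic]). It remains to
    see that an isotropic nu that does not split is stable, and this is a matter
    of rigidity. If nu is isotropic for h and for h'(u, v) = h(S u, v), then
    subtracting the two conditions tested on S gives
      int (h'(Sz, z) / h'(z, z) - h(Sz, z) / h(z, z)) dnu = 0,
    where the integrand is nonnegative and vanishes only if z is an eigenvector of
    S ([rayleigh_comparison]). So nu is carried by the projective spaces of
    ker (S - c) and im (S - c), for any eigenvalue c of S, and S is scalar because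
    nu does not split ([isotropic_unique]). Applied to the pull-back of h along an
    element of the stabilizer of nu, this makes the stabilizer unitary. Hence if
    exp(tA) fixes nu for all real t, comparing exp(tA) with 1 + tA at first order
    shows that A is skew-Hermitian of trace zero
    ([unitary_one_parameter_su]). *)

Set Implicit Arguments.
Unset Strict Implicit.
Unset Printing Implicit Defensive.

(* The name is also that of the projections of a product space. *)
Local Notation proj := Defs.proj.

(** * The trace of an endomorphism *)

Section Trace.
Variable F : fieldType.
Implicit Types V W : vectType F.

Definition endtr V (X : 'End(V)) : F := \tr (mxof (vbasis {:V}) (vbasis {:V}) X).

Fact endtr_is_scalar V : scalar (@endtr V).
Proof. by move=> a X Y; rewrite /endtr linearP /= mxtraceD mxtraceZ. Qed.

HB.instance Definition _ V :=
  GRing.isSemilinear.Build F 'End(V) F *%R (@endtr V)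
    (GRing.semilinear_linear (@endtr_is_scalar V)).

Lemma endtrE V (X : 'End(V)) :
  endtr X = \sum_i coord (vbasis {:V}) i (X (vbasis {:V})`_i).
Proof. by apply: eq_bigr => i _; rewrite !mxE /= vecof_delta. Qed.

Lemma endtr_comp V W (f : 'Hom(V, W)) (g : 'Hom(W, V)) :
  endtr (g \o f)%VF = endtr (f \o g)%VF.
Proof.
by rewrite /endtr (mxof_comp _ _ (vbasisP {:W})) mxtrace_mulC
  -(mxof_comp _ _ (vbasisP {:V})).
Qed.

Lemma endtr1 V : endtr (\1%VF : 'End(V)) = (\dim {:V})%:R.
Proof. by rewrite /endtr mxof1 ?mxtrace1 // (basis_free (vbasisP _)). Qed.

(** Applied to the orthogonal projection onto a line followed by B, this turns
    the trace of B against the momentum map into a Rayleigh quotient. *)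
Lemma endtr_rank1 V (X : 'End(V)) (phi : {scalar V}) (w : V) :
  (forall u, X u = phi u *: w) -> endtr X = phi w.
Proof.
move=> Xw; rewrite endtrE [w in RHS](coord_vbasis (memvf w)) linear_sum /=.
by apply: eq_bigr => i _; rewrite Xw !linearZ /= mulrC.
Qed.

(** Nondegeneracy of the trace form; it relates the coordinates in which
    endomorphism-valued integrals are defined to traces. *)
Lemma endtr_dual V (psi : {scalar 'End(V)}) :
  exists B : 'End(V), forall X, psi X = endtr (B \o X)%VF.
Proof.
have eV := vbasisP {:V}; set e := vbasis {:V}.
exists (hommx e e (\matrix_(i, j) psi (hommx e e (delta_mx j i)))) => X.
rewrite /endtr (mxof_comp _ _ eV) hommxK // -[X in psi X](mxofK eV eV).
rewrite [mxof _ _ X in LHS]matrix_sum_delta !linear_sum /=.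
apply: eq_bigr => i _; rewrite mxE !linear_sum /=.
by apply: eq_bigr => j _; rewrite !linearZ /= mxE.
Qed.

End Trace.

(** * Orthonormal bases and Hermitian products *)

Section OrthonormalBasis.
Variables (C : numClosedFieldType) (V : vectType C).
Implicit Types h : {dot V for Num.conj}.

Lemma dotC h u v : h u v = Num.conj (h v u).
Proof. by rewrite hermC expr0 mul1r. Qed.

Lemma dot_real h u : h u u \is Num.real.
Proof. by rewrite ger0_real ?dnorm_ge0. Qed.

Lemma dot_gt0 h u : u != 0 -> 0 < h u u.
Proof. by rewrite -(dnorm_gt0 h). Qed.

Lemma ex_orthonormal h k : (k <= \dim {:V})%N ->
  exists b : k.-tuple V, orthonormal h b.
Proof.
elim: k => [_|k IH lek]; first by exists [tuple].
have [b bon] := IH (ltnW lek).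
have [v vb] : exists v, v \notin <<b>>%VS.
  apply: contrapT => /forallNP bT.
  have bf : (fullv <= <<b>>)%VS.
    by apply/subvP => v _; apply: contraT => nv; case: (bT v).
  have := dim_span b; rewrite size_tuple leqNgt.
  by rewrite (leq_trans lek) // dimvS.
have [X Xb [Y [vXY XY /andP[Yb _]]]] := orthogonal_split h b v.
have Y0 : Y != 0.
  by apply: contraNneq vb => Y0; rewrite vXY Y0 addr0.
exists [tuple of (sqrtC (h Y Y))^-1 *: Y :: b].
rewrite /= -cat1s orthonormal_cat bon /orthonormal /= !andbT.
apply/andP; split.
  rewrite dnormZ normfV ger0_norm ?sqrtC_ge0 ?dnorm_ge0 //.
  by rewrite exprVn sqrtCK mulVf ?dnorm_eq0.
apply/allP => w wb /=; rewrite linearZl_LR /=.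
by move/allP: Yb => /(_ w wb) /eqP ->; rewrite mulr0.
Qed.

Section Coordinates.
Variables (h : {dot V for Num.conj}) (b : (\dim {:V}).-tuple V).
Hypothesis bon : orthonormal h b.

Lemma orthonormal_basis : basis_of {:V} b.
Proof. by rewrite basisEfree (orthonormal_free bon) subvf size_tuple leqnn. Qed.

Lemma dot_orthonormal (i j : 'I_(\dim {:V})) : h b`_i b`_j = (i == j)%:R.
Proof.
have /orthonormalP[ub ->] := bon; rewrite ?mem_nth ?size_tuple //.
by rewrite nth_uniq ?size_tuple.
Qed.

Lemma orthonormal_coord (u : V) : u = \sum_(i < \dim {:V}) h u b`_i *: b`_i.
Proof.
rewrite [u in LHS](coord_basis orthonormal_basis (memvf u)).
apply: eq_bigr => i _; congr (_ *: _).
rewrite [u in RHS](coord_basis orthonormal_basis (memvf u)) linear_sumlz /=.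
rewrite (bigD1 i) //= linearZl_LR /= dot_orthonormal eqxx mulr1 big1 ?addr0 //.
by move=> j ji; rewrite linearZl_LR /= dot_orthonormal (negbTE ji) mulr0.
Qed.

Lemma orthonormal_coordE (i : 'I_(\dim {:V})) u : coord b i u = h u b`_i.
Proof.
rewrite [u in LHS]orthonormal_coord.
by rewrite (coord_sum_free _ _ (basis_free orthonormal_basis)).
Qed.

Lemma orthonormal_dot (u v : V) :
  h u v = \sum_(i < \dim {:V}) h u b`_i * Num.conj (h v b`_i).
Proof.
rewrite [v in LHS]orthonormal_coord linear_sumr.
by apply: eq_bigr => i _; rewrite linearZr_LR /= mulrC.
Qed.

End Coordinates.

(** Riesz representation: in an orthonormal basis b, the vector S u has the
    coordinates psi u b_i. *)
Lemma dot_represent h (psi : V -> V -> C) :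
    bilinear_for *%R (Num.conj \; *%R) psi ->
  exists S : 'End(V), forall u v, h (S u) v = psi u v.
Proof.
move=> [psil psir].
have [b bon] := ex_orthonormal h (leqnn _).
have lin : linear (fun u => \sum_(i < \dim {:V}) psi u b`_i *: b`_i).
  move=> a u w; rewrite scaler_sumr -big_split /=; apply: eq_bigr => i _.
  by rewrite psil scalerDl scalerA.
pose L := GRing.isLinear.Build _ _ _ _ _ lin.
pose F : {linear V -> V} :=
  HB.pack (fun u => \sum_(i < \dim {:V}) psi u b`_i *: b`_i) L.
exists (linfun F) => u v; rewrite lfunE /=.
have psiv w : psi u w = \sum_(i < \dim {:V}) Num.conj (h w b`_i) * psi u b`_i.
  pose M := GRing.isLinear.Build _ _ _ _ _ (psir u).
  pose G : {linear V -> C | Num.conj \; *%R} := HB.pack (psi u) M.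
  rewrite -[psi u]/(G : V -> C) [w in LHS](orthonormal_coord bon) linear_sum /=.
  by apply: eq_bigr => i _; exact: (linearZ_LR G).
rewrite psiv linear_sumlz /=; apply: eq_bigr => i _.
by rewrite linearZl_LR /= mulrC -dotC.
Qed.

End OrthonormalBasis.

Section Constructions.
Variable C : numClosedFieldType.
Implicit Types V W : vectType C.

Section Pull.
Variables (V W : vectType C) (h : {dot W for Num.conj}) (f : 'Hom(V, W)).
Hypothesis f0 : lker f == 0%VS.

(** The proof of injectivity is an argument, so that the positivity of the
    pulled back product can be found by inference. *)
Definition dot_pull of lker f == 0%VS := fun u v : V => h (f u) (f v).

Local Notation hf := (dot_pull f0).

Fact dot_pull_bilinear : bilinear_for *%R (Num.conj \; *%R) hf.
Proof. by split=> u a v w; rewrite /dot_pull linearP ?linearPl ?linearPr. Qed.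

HB.instance Definition _ :=
  bilinear_isBilinear.Build _ _ _ _ _ _ hf dot_pull_bilinear.

Fact dot_pull_herm u v : hf u v = (-1) ^+ false * Num.conj (hf v u).
Proof. exact: hermC. Qed.

HB.instance Definition _ :=
  isHermitianSesquilinear.Build _ _ _ _ hf dot_pull_herm.

Fact dot_pull_gt0 u : u != 0 -> 0 < hf u u.
Proof.
move=> u0; apply: neq0_dnorm_gt0; apply: contra u0 => /eqP fu0.
by apply/eqP/(lker0P f0); rewrite fu0 linear0.
Qed.

HB.instance Definition _ := isDotProduct.Build _ _ hf dot_pull_gt0.

End Pull.

Section Sum.
Variables (V : vectType C) (I : finType) (W : I -> vectType C).
Variables (h : forall i, {dot W i for Num.conj}) (f : forall i, 'Hom(V, W i)).
Hypothesis f0 : forall u, (forall i, f i u = 0) -> u = 0.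

(** The joint injectivity of the f i is an argument for the same reason as in
    the case of a single map; it makes the sum positive definite. *)
Definition dot_sum of (forall u, (forall i, f i u = 0) -> u = 0) :=
  fun u v : V => \sum_i h i (f i u) (f i v).

Local Notation hs := (dot_sum f0).

Fact dot_sum_bilinear : bilinear_for *%R (Num.conj \; *%R) hs.
Proof.
split=> u a v w; rewrite /dot_sum /= mulr_sumr -big_split /=;
  by apply: eq_bigr => i _; rewrite linearP ?linearPl ?linearPr.
Qed.

HB.instance Definition _ :=
  bilinear_isBilinear.Build _ _ _ _ _ _ hs dot_sum_bilinear.

Fact dot_sum_herm u v : hs u v = (-1) ^+ false * Num.conj (hs v u).
Proof.
rewrite expr0 mul1r /dot_sum rmorph_sum; apply: eq_bigr => i _; exact: dotC.
Qed.

HB.instance Definition _ :=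
  isHermitianSesquilinear.Build _ _ _ _ hs dot_sum_herm.

Fact dot_sum_gt0 u : u != 0 -> 0 < hs u u.
Proof.
move=> u0; have [i fi0] : exists i, f i u != 0.
  apply: contrapT => /forallNP fu; move/eqP: u0; apply; apply: f0 => i.
  by apply/eqP; apply: contraT => fi0; case: (fu i).
rewrite /dot_sum (bigD1 i) //= ltr_wpDr ?dot_gt0 //.
by apply: sumr_ge0 => j _; exact: dnorm_ge0.
Qed.

HB.instance Definition _ := isDotProduct.Build _ _ hs dot_sum_gt0.

End Sum.
End Constructions.

(** Matching an orthonormal basis of h' with one of h gives an isometry, and
    multiplying it by a root of the inverse of its determinant lands in SL(V) at
    the price of a positive factor. This is why the stability notions do not
    depend on the Hermitian product. *)
Lemma dot_equiv (R : realType) (V : vectType R[i]) (h h' : {dot V for Num.conj}) :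
  exists (g : SL V) (c : R[i]),
    0 < c /\ forall u v, h (val g u) (val g v) = c * h' u v.
Proof.
have [b bon] := ex_orthonormal h (leqnn _).
have [b' bon'] := ex_orthonormal h' (leqnn _).
have [N0|N0] := posnP (\dim {:V}).
  have det1 : \det (mxof (vbasis {:V}) (vbasis {:V}) \1%VF) == 1.
    by rewrite mxof1 ?det1 // (basis_free (vbasisP _)).
  exists (exist _ \1%VF det1), 1; split=> // u v.
  have /eqP u0 : u == 0 by rewrite -memv0 -(eqP (_ : fullv == 0%VS)) ?memvf // -dimv_eq0 N0.
  by rewrite u0 linear0 !linear0l mulr0.
have B := orthonormal_basis bon; have B' := orthonormal_basis bon'.
pose T : 'End(V) := hommx b' b 1%:M.
have hT u v : h (T u) (T v) = h' u v.
  rewrite (orthonormal_dot bon) (orthonormal_dot bon'); apply: eq_bigr => i _.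
  rewrite -!(orthonormal_coordE bon) -!(orthonormal_coordE bon').
  by rewrite !hommxE // !mulmx1 !coord_vecof // !mxE.
set e := vbasis {:V}; have E := vbasisP {:V}.
have T1 : (hommx b b' 1%:M \o T)%VF = \1%VF.
  by rewrite -(hommx_mul B' B B') mul1mx hommx1.
have /mulmx1_unit[uT _] : mxof e e T *m mxof e e (hommx b b' 1%:M) = 1%:M.
  by rewrite -(mxof_comp _ _ E) T1 mxof1 // (basis_free E).
(* A root of the inverse determinant normalizes T to determinant 1. *)
pose a := (\dim {:V}).-root (\det (mxof e e T))^-1.
have aN : a ^+ (\dim {:V}) = (\det (mxof e e T))^-1 by rewrite rootCK.
have dT : \det (mxof e e T) != 0 by rewrite -unitfE -unitmxE.
have a0 : a != 0.
  apply: contraNneq (invr_neq0 dT) => a0.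
  by rewrite -aN a0 expr0n -leqn0 leqNgt N0.
have dg : \det (mxof e e (a *: T)) == 1 by rewrite linearZ /= detZ aN mulVf.
exists (exist _ (a *: T) dg), (`|a| ^+ 2); split; first by rewrite exprn_gt0 ?normr_gt0.
move=> u v /=; rewrite !lfunE /= linearZl_LR linearZr_LR /= hT mulrA.
by rewrite normCK.
Qed.

(** * Maps and subsets of projective spaces *)

Section Lines.
Variable R : realType.
Implicit Types V W : vectType R[i].

Lemma pline_surj V (L : proj V) : fullv != 0%VS :> {vspace V} ->
  vpick (val L) != 0 /\ L = pline (vpick (val L)).
Proof.
rewrite -dimv_eq0 -lt0n => V0.
have dL : \dim (val L) = 1%N by rewrite (eqP (valP L)); exact/minn_idPl.
have z0 : vpick (val L) != 0 by rewrite vpick0 -dimv_eq0 dL.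
split=> //; apply: val_inj; rewrite val_pline //; apply/esym/eqP.
by rewrite eqEdim -memvE memv_pick dL dim_vline z0.
Qed.

Lemma proj_openP V (P : set (proj V)) : open P <->
  open [set x : 'rV[R[i]]_(\dim {:V}) |
    x != 0 /\ P (pline (vecof (vbasis {:V}) x))].
Proof. by []. Qed.

(** A linear map that is not injective still induces a continuous map on the
    open set of lines that it does not kill. *)
Lemma projmap_open V W (f : 'Hom(V, W)) (P : set (proj W)) : open P ->
  open [set L : proj V | (f @: val L)%VS != 0%VS /\ P (projmap f L)].
Proof.
have eV := vbasisP {:V}; have eW := vbasisP {:W}.
rewrite !proj_openP => oP.
have := open_comp (fun x _ => @mulmxr_continuous _ _ _
  (mxof (vbasis {:V}) (vbasis {:W}) f) x) oP.
congr open; apply/seteqP; split => x /=.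
  rewrite mul_mxof -(rVofK eW (f _)) !vecofK// rVof_eq0// => -[fx0 Px].
  have x0 : vecof (vbasis {:V}) x != 0.
    by apply: contraNneq fx0 => ->; rewrite linear0.
  rewrite -(vecof_eq0 eV) x0 val_pline // limg_line projmap_pline //.
  by rewrite -dimv_eq0 dim_vline fx0 -(rVofK eW (f _)).
rewrite -(vecof_eq0 eV) mul_mxof rVof_eq0// rVofK// => -[x0].
rewrite val_pline // limg_line projmap_pline // -dimv_eq0 dim_vline.
by case: (f _ =P 0) => // fx0; rewrite eqxx => -[].
Qed.

Lemma measurable_nonkernel V W (f : 'Hom(V, W)) :
  measurable [set L : projB V | (f @: val L)%VS != 0%VS].
Proof.
apply: sub_sigma_algebra; have := @projmap_open V W f _ openT.
by congr open; apply/seteqP; split=> L //= [].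
Qed.

(** This covers projections onto a direct summand, whose kernel is not zero;
    on the lines inside the kernel the induced map is constant by convention. *)
Lemma measurable_projmap_linear V W (f : 'Hom(V, W)) :
  measurable_fun [set: projB V] (projmap f : projB V -> projB W).
Proof.
apply: (@measurability _ _ (projB V) (projB W) setT (projmap f)
  (@open (proj W)) erefl).
move=> _ [U oU <-]; rewrite setTI.
pose D := [set L : projB V | (f @: val L)%VS != 0%VS].
have mD : measurable D by exact: measurable_nonkernel.
have -> : projmap f @^-1` U = [set L : projB V | (f @: val L)%VS != 0%VS /\
    U (projmap f L)] `|` (~` D `&` [set _ | U (insubd (point : proj W) 0%VS)]).
  apply/seteqP; split=> L /=.
    rewrite /projmap /D /=; have [->|fL] := eqVneq (f @: val L)%VS 0%VS => UL.
      by right.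
    by left.
  by case=> [[]//|[]]; rewrite /D /= => /negP; rewrite negbK /projmap => /eqP ->.
apply: measurableU; first by apply: sub_sigma_algebra; exact: projmap_open.
apply: measurableI; first exact: measurableC.
have [pU|pU] := pselect (U (insubd (point : proj W) 0%VS)).
  by rewrite (_ : [set _ | _] = setT) //; apply/seteqP; split.
by rewrite (_ : [set _ | _] = set0) //; apply/seteqP; split.
Qed.

Definition projmapB V W (f : 'Hom(V, W)) : projB V -> projB W := projmap f.

HB.instance Definition _ V W (f : 'Hom(V, W)) :=
  isMeasurableFun.Build _ _ _ _ (projmapB f) (measurable_projmap_linear f).

Definition subproj V (U : {vspace V}) : set (projB V) :=
  [set L | (val L <= U)%VS].

Lemma measurable_subproj V (U : {vspace V}) : measurable (subproj U).
Proof.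
pose f : 'End(V) := (\1 - projv U)%VF.
have := measurableC (measurable_nonkernel f); congr measurable.
have kf v : (f v == 0) = (v \in U).
  rewrite /f add_lfunE opp_lfunE id_lfunE subr_eq0 eq_sym.
  by apply/eqP/idP => [<-|/projv_id ->//]; exact: memv_proj.
apply/seteqP; split=> L /=; rewrite /subproj /=.
  move=> /negP; rewrite negbK => /eqP fL; apply/subvP => v vL.
  by rewrite -kf -memv0 -fL memv_img.
move=> /subvP LU; apply/negP; rewrite negbK -subv0; apply/subvP => _ /memv_imgP[v vL ->].
by rewrite memv0 kf LU.
Qed.

Lemma subproj_pline V (U : {vspace V}) v : v != 0 ->
  subproj U (pline v) <-> v \in U.
Proof. by move=> v0; rewrite /subproj /= val_pline // -memvE. Qed.

End Lines.

(** * Continuity and boundedness of Rayleigh quotients *)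

Section ComplexContinuity.
Variable R : realType.

Lemma ReB (x y : R[i]) : complex.Re (x - y) = complex.Re x - complex.Re y.
Proof. by case: x; case: y. Qed.

Lemma ReD (x y : R[i]) : complex.Re (x + y) = complex.Re x + complex.Re y.
Proof. by case: x; case: y. Qed.

Lemma Re_sum (I : Type) (r : seq I) (P : pred I) (F : I -> R[i]) :
  complex.Re (\sum_(i <- r | P i) F i) = \sum_(i <- r | P i) complex.Re (F i).
Proof. exact: (big_morph _ ReD). Qed.

Lemma ReZ (a : R) (x : R[i]) : complex.Re (a%:C%C * x) = a * complex.Re x.
Proof. by case: x => b c /=; rewrite mul0r subr0. Qed.

Lemma Re_nat n : complex.Re (n%:R : R[i]) = n%:R.
Proof. by rewrite -(rmorph_nat (real_complex R) n). Qed.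

Lemma Re_continuous : continuous (@complex.Re R : R[i] -> R).
Proof.
move=> x; apply/(@cvgrPdist_lt _ _ _ (nbhs x)) => e e0.
have e0' : 0 < e%:C%C :> R[i] by rewrite ltcR.
near=> y; rewrite -ltcR.
rewrite -ReB.
apply: le_lt_trans (normc_ge_Re _) _.
near: y; apply: (@cvgr_dist_lt _ _ _ (nbhs x) _ id x) => //; exact: cvg_id.
Unshelve. all: by end_near. Qed.

Lemma conj_continuous : continuous (Num.conj : R[i] -> R[i]).
Proof.
move=> x; apply/(@cvgrPdist_lt _ _ _ (nbhs x)) => e e0; near=> y.
rewrite -rmorphB norm_conjC.
near: y; apply: (@cvgr_dist_lt _ _ _ (nbhs x) _ id x) => //; exact: cvg_id.
Unshelve. all: by end_near. Qed.

Lemma dot_vecof_continuous (V : vectType R[i]) (h : {dot V for Num.conj})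
    (B : 'End(V)) :
  continuous (fun x : 'rV[R[i]]_(\dim {:V}) =>
    h (B (vecof (vbasis {:V}) x)) (vecof (vbasis {:V}) x)).
Proof.
set e := vbasis {:V}.
have -> : (fun x => h (B (vecof e x)) (vecof e x)) =
    (fun x : 'rV[R[i]]_(\dim {:V}) => \sum_i \sum_j
      x 0 i * (Num.conj (x 0 j) * h (B e`_i) e`_j)).
  apply/funext => x; rewrite /vecof [B _]linear_sum linear_sumlz /=.
  apply: eq_bigr => i _; rewrite linear_sumr; apply: eq_bigr => j _.
  by rewrite linearZr_LR [B _]linearZ linearZl_LR /= mulrCA.
apply: (continuous_big add_continuous) => i _.
apply: (continuous_big add_continuous) => j _ x.
apply: (@cvgM _ _ (nbhs x)); first exact: coord_continuous.
apply: (@cvgM _ _ (nbhs x)); last exact: cvg_cst.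
apply: (@continuous_comp _ _ _ (fun y : 'rV[R[i]]_(\dim {:V}) => y 0 j)).
  exact: coord_continuous.
exact: conj_continuous.
Qed.

End ComplexContinuity.

Section Rayleigh.
Variables (R : realType) (V : vectType R[i]).
Implicit Types (h : {dot V for Num.conj}) (B : 'End(V)).

(** The real part suffices: up to sign, replacing B by i B gives the imaginary
    part. *)
Definition rayleigh h B (L : proj V) : R :=
  complex.Re (h (B (vpick (val L))) (vpick (val L)) /
              h (vpick (val L)) (vpick (val L))).

Lemma rayleigh_pline h B v : v != 0 ->
  rayleigh h B (pline v) = complex.Re (h (B v) v / h v v).
Proof.
move=> v0; rewrite /rayleigh val_pline //.
have := memv_pick <[v]>; have : vpick <[v]> != 0 by rewrite vpick0 -dimv_eq0 dim_vline v0.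
move=> + /vlineP[k kv]; rewrite kv scaler_eq0 negb_or => /andP[k0 _].
have hk (X : 'End(V)) : h (X (k *: v)) (k *: v) = (k * k^*) * h (X v) v.
  by rewrite [X _]linearZ linearZr_LR linearZl_LR /= mulrCA mulrA.
have := hk \1%VF; rewrite !id_lfunE => ->.
by rewrite hk -mulf_div mulfV ?mul1r // mulf_neq0 // conjC_eq0.
Qed.

(** The quotient topology is tested in coordinates, where the function is a
    quotient of two polynomials in the coordinates and their conjugates. *)
Lemma rayleigh_continuous h B : continuous (rayleigh h B).
Proof.
apply/continuousP => O oO; rewrite proj_openP.
set e := vbasis {:V}; have eV : basis_of {:V} e := vbasisP _.
rewrite openE => x /= [x0 Ox]; rewrite /interior /=.
pose q (x : 'rV[R[i]]_(\dim {:V})) :=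
  complex.Re (h (B (vecof e x)) (vecof e x) / h (vecof e x) (vecof e x)).
have qE y : y != 0 -> rayleigh h B (pline (vecof e y)) = q y.
  by move=> y0; rewrite rayleigh_pline ?vecof_eq0.
have v0 : vecof e x != 0 by rewrite vecof_eq0.
have near0 : \forall y \near x, y != 0.
  have := open_nbhs_nbhs (conj (@proj_openT R V) (conj x0 I)).
  by apply: filterS => y [].
have cq : q y @[y --> x] --> q x.
  apply: (@continuous_comp _ _ _ (fun y => h (B (vecof e y)) (vecof e y) /
    h (vecof e y) (vecof e y))); last exact: Re_continuous.
  apply: (@cvgM _ _ (nbhs x)); first exact: dot_vecof_continuous.
  apply: (@cvgV _ _ (nbhs x)); first by rewrite dnorm_eq0.
  have := @dot_vecof_continuous R V h \1%VF x.
  by rewrite /continuous_at; under eq_fun do rewrite id_lfunE; rewrite id_lfunE.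
have : \forall y \near x, O (q y).
  by apply: cq; rewrite -qE //; exact: open_nbhs_nbhs.
apply: filterS2 near0 => y y0 Oy; split=> //.
by rewrite qE.
Qed.

Lemma measurable_rayleigh h B :
  measurable_fun [set: projB V] (rayleigh h B : projB V -> R).
Proof.
apply: (measurability _ (RGenOpens.measurableE R)) => //.
move=> _ [_ [a [b ->]] <-]; rewrite setTI; apply: sub_sigma_algebra.
have /continuousP := @rayleigh_continuous h B.
by apply; exact: interval_open.
Qed.

(** In an orthonormal basis every coordinate of z is at most |z| in modulus, so
    the sum of the moduli of the matrix entries of B is a bound. *)
Lemma rayleigh_bounded h B :
  exists M : R, forall L : proj V, `|rayleigh h B L| <= M.
Proof.
have [b bon] := ex_orthonormal h (leqnn _).
pose M : R[i] := \sum_(i < \dim {:V}) \sum_(j < \dim {:V}) `|h (B b`_i) b`_j|.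
have M0 : 0 <= M by apply: sumr_ge0 => i _; exact: sumr_ge0.
exists (complex.Re M) => L; rewrite /rayleigh; set z := vpick _.
rewrite -lecR; apply: le_trans (normc_ge_Re _) _; rewrite RRe_real ?ger0_real //.
have [->|z0] := eqVneq z 0; first by rewrite linear0r mul0r normr0.
have hz := dot_gt0 h z0.
rewrite normrM normfV [`|h z z|]ger0_norm ?(ltW hz) //.
rewrite ler_pdivrMr //.
have zb (i : 'I_(\dim {:V})) : `|h z b`_i| <= sqrtC (h z z).
  have [+ _] := CauchySchwarz_sqrt h z b`_i.
  by rewrite (dot_orthonormal bon) eqxx sqrtC1 mulr1.
rewrite [z in h (B z) _](orthonormal_coord bon) [B _]linear_sum linear_sumlz /=.
apply: le_trans (ler_norm_sum _ _ _) _; rewrite /M mulr_suml.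
apply: ler_sum => i _; rewrite [B _]linearZ linearZl_LR /= [h (B _) _](orthonormal_dot bon).
rewrite mulr_suml mulr_sumr; apply: le_trans (ler_norm_sum _ _ _) _.
apply: ler_sum => j _; rewrite !normrM norm_conjC.
rewrite mulrCA ler_wpM2l // -[h z z]sqrtCK expr2 ler_pM ?normr_ge0 ?zb //.
Qed.

Lemma integrable_rayleigh (nu : probability (projB V) R) h B :
  nu.-integrable [set: projB V] (EFin \o (rayleigh h B : projB V -> R)).
Proof.
apply: measurable_bounded_integrable => //.
- by rewrite [X in (X < _)%E]probability_setT ltry.
- exact: measurable_rayleigh.
have [M Mb] := rayleigh_bounded h B.
exists M; split; first exact: num_real.
by move=> x Mx L _ /=; exact: le_trans (Mb L) (ltW Mx).
Qed.

End Rayleigh.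

(** * Isotropic measures *)

Section RintegralSum.
Context d (T : measurableType d) (R : realType) (mu : {measure set T -> \bar R}).

Lemma integrable_Rsum (I : eqType) (r : seq I) (f : I -> T -> R) :
  (forall i, mu.-integrable setT (EFin \o f i)) ->
  mu.-integrable setT (EFin \o (fun x => \sum_(i <- r) f i x)).
Proof.
move=> fi; elim: r => [|i r IH].
  apply: (eq_integrable _ (cst 0%E)) => //; last exact: integrable0.
  by move=> x _; rewrite /= big_nil.
apply: (eq_integrable _ ((EFin \o f i) \+ (EFin \o (fun x => \sum_(i <- r) f i x)%R))%E) => //.
  by move=> x _; rewrite /= big_cons EFinD.
exact: integrableD.
Qed.

Lemma Rintegral_sum (I : eqType) (r : seq I) (f : I -> T -> R) :
  (forall i, mu.-integrable setT (EFin \o f i)) ->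
  \int[mu]_x (\sum_(i <- r) f i x) = \sum_(i <- r) \int[mu]_x f i x.
Proof.
move=> fi; elim: r => [|i r IH].
  rewrite big_nil; under eq_Rintegral do rewrite big_nil.
  by rewrite /Rintegral integral0.
rewrite big_cons -IH -RintegralD //; last exact: integrable_Rsum.
by apply: eq_Rintegral => x _; rewrite big_cons.
Qed.

Lemma integrable_Rlin (f g : T -> R) a b :
  mu.-integrable setT (EFin \o f) -> mu.-integrable setT (EFin \o g) ->
  mu.-integrable setT (EFin \o (fun x => f x * a - g x * b)).
Proof.
move=> fi gi; apply: (eq_integrable measurableT
   ((fun x => a%:E * (EFin \o f) x) \- (fun x => b%:E * (EFin \o g) x))%E) => //.
  by move=> x _; rewrite /= -!EFinM -EFinB ![_ * a]mulrC ![_ * b]mulrC.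
by apply: integrableB => //; exact: integrableZl.
Qed.

Lemma Rintegral_lin (f g : T -> R) a b :
  mu.-integrable setT (EFin \o f) -> mu.-integrable setT (EFin \o g) ->
  \int[mu]_x (f x * a - g x * b) = (\int[mu]_x f x) * a - (\int[mu]_x g x) * b.
Proof.
move=> fi gi; rewrite RintegralB //; first by rewrite !RintegralZr.
- apply: (eq_integrable measurableT (fun x => a%:E * (EFin \o f) x)%E) => //.
    by move=> x _; rewrite /= -!EFinM mulrC.
  exact: integrableZl.
- apply: (eq_integrable measurableT (fun x => b%:E * (EFin \o g) x)%E) => //.
    by move=> x _; rewrite /= -!EFinM mulrC.
  exact: integrableZl.
Qed.

End RintegralSum.

Section Isotropic.
Variables (R : realType) (V : vectType R[i]).
Implicit Types (h : {dot V for Num.conj}) (nu : probability (projB V) R).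
Implicit Types (B : 'End(V)).

(** Tested against an endomorphism B, this says that the average of the
    orthogonal projections onto the lines is a multiple of the identity. *)
Definition isotropic h nu := forall B,
  \int[nu]_L rayleigh h B L = complex.Re (endtr B) / (\dim {:V})%:R.

(** Equals the real part of the trace of i B against the momentum. *)
Definition deviation h B (L : projB V) : R :=
  rayleigh h B L - complex.Re (endtr B) / (\dim {:V})%:R.

Lemma integrable_deviation nu h B :
  nu.-integrable [set: projB V] (EFin \o deviation h B).
Proof.
apply: (eq_integrable measurableT ((EFin \o (rayleigh h B : projB V -> R)) \-
   (EFin \o cst (complex.Re (endtr B) / (\dim {:V})%:R)%R))%E) => //.
apply: integrableB => //; first exact: integrable_rayleigh.
exact: finite_measure_integrable_cst.
Qed.

Lemma integral_deviation nu h B :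
  \int[nu]_L deviation h B L =
    \int[nu]_L rayleigh h B L - complex.Re (endtr B) / (\dim {:V})%:R.
Proof.
rewrite RintegralB //; first 1 last.
- exact: integrable_rayleigh.
- exact: finite_measure_integrable_cst.
rewrite Rintegral_cst // [X in fine X](_ : _ = 1%E) ?mulr1 //.
exact: probability_setT.
Qed.

Lemma isotropicP h nu :
  isotropic h nu <-> forall B, \int[nu]_L deviation h B L = 0.
Proof.
split=> [iso B|dev B]; first by rewrite integral_deviation iso subrr.
by apply/eqP; rewrite -subr_eq0 -integral_deviation dev.
Qed.

Lemma endtr_momentum h B (L : proj V) :
  endtr (B \o momentum h L)%VF =
  - 'i * (h (B (vpick (val L))) (vpick (val L)) /
          h (vpick (val L)) (vpick (val L)) - endtr B / (\dim {:V})%:R).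
Proof.
rewrite /momentum; set z := vpick _.
rewrite comp_lfunNr linearN /= -comp_lfunZr linearZ /= mulNr; congr (- (_ * _)).
rewrite comp_lfunDr linearD /= comp_lfunNr linearN /= -comp_lfunZr linearZ /=.
rewrite comp_lfun1r [_^-1 * _]mulrC; congr (_ - _).
have lin : scalar (fun v => h v z / h z z).
  by move=> a u w; rewrite linearPl /= mulrDl mulrA.
pose L' := GRing.isLinear.Build _ _ _ _ _ lin.
pose F : {scalar V} := HB.pack (fun v => h v z / h z z) L'.
rewrite (@endtr_rank1 _ _ _ F (B z)) // => u.
by rewrite comp_lfunE line_projE linearZ.
Qed.

Lemma deviationE h B (L : proj V) : deviation h B L =
  complex.Re (h (B (vpick (val L))) (vpick (val L)) /
    h (vpick (val L)) (vpick (val L)) - endtr B / (\dim {:V})%:R).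
Proof.
rewrite /deviation /rayleigh ReB; congr (_ - _).
have -> : ((\dim {:V})%:R : R[i])^-1 = ((\dim {:V})%:R^-1 : R)%:C%C.
  by rewrite fmorphV rmorph_nat.
by rewrite [in RHS]mulrC ReZ mulrC.
Qed.

Lemma deviationZ h (k : R[i]) B (L : proj V) : deviation h (k *: B) L =
  complex.Re (k * (h (B (vpick (val L))) (vpick (val L)) /
    h (vpick (val L)) (vpick (val L)) - endtr B / (\dim {:V})%:R)).
Proof.
rewrite deviationE; congr complex.Re; rewrite [in RHS]mulrBr !mulrA.
have -> : endtr (k *: B) = k * endtr B by rewrite linearZ.
by rewrite scale_lfunE; set z := vpick _; rewrite [h (k *: _) _]linearZl_LR.
Qed.

Lemma Re_endtr_momentum h B (L : proj V) :
  complex.Re (endtr (B \o momentum h L)%VF) = deviation h (- 'i *: B) L.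
Proof. by rewrite endtr_momentum deviationZ. Qed.

Lemma Im_endtr_momentum h B (L : proj V) :
  complex.Im (endtr (B \o momentum h L)%VF) = deviation h ((-1) *: B) L.
Proof.
rewrite endtr_momentum deviationZ -complexiE mulN1r mulNr.
by case: (_ - _) => a b /=; ring.
Qed.

(** The vector-valued integral is defined by coordinates in a basis of End(V).
    Each coordinate is a trace against some B, and conversely each trace is a
    linear combination of the coordinates. *)
Lemma frakF_eq0 h nu : frakF h nu = 0 <-> isotropic h nu.
Proof.
set e := vbasis {:'End(V)}.
have eB : basis_of {:'End(V)} e := vbasisP _.
have cE k : exists B, forall L, coord e k (momentum h L) =
    endtr (B \o momentum h L)%VF.
  have [B BP] := endtr_dual (coord e k).
  by exists B => L; rewrite -BP.
rewrite isotropicP; split=> [F0 B|iso]; last first.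
  rewrite /frakF /vintegral big1 // => k _; have [B BP] := cE k.
  under eq_Rintegral do rewrite BP Re_endtr_momentum.
  rewrite iso; under eq_Rintegral do rewrite BP Im_endtr_momentum.
  by rewrite iso [Complex 0 0](_ : _ = 0) // scale0r.
have iRe k : nu.-integrable setT
    (EFin \o (fun L => complex.Re (coord e k (momentum h L)))).
  have [Bk BP] := cE k.
  apply: (eq_integrable measurableT (EFin \o deviation h (- 'i *: Bk))) => //.
    by move=> L _; rewrite /= BP Re_endtr_momentum.
  exact: integrable_deviation.
have iIm k : nu.-integrable setT
    (EFin \o (fun L => complex.Im (coord e k (momentum h L)))).
  have [Bk BP] := cE k.
  apply: (eq_integrable measurableT (EFin \o deviation h ((-1) *: Bk))) => //.
    by move=> L _; rewrite /= BP Im_endtr_momentum.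
  exact: integrable_deviation.
have c0 k : \int[nu]_L complex.Re (coord e k (momentum h L)) = 0 /\
            \int[nu]_L complex.Im (coord e k (momentum h L)) = 0.
  have /freeP fr := basis_free eB.
  by move: F0; rewrite /frakF /vintegral => /fr /(_ k) [].
have dE L : deviation h B L = \sum_k
    (complex.Re (coord e k (momentum h L)) * complex.Re ('i * endtr (B \o e`_k)%VF)
   - complex.Im (coord e k (momentum h L)) * complex.Im ('i * endtr (B \o e`_k)%VF)).
  have -> : deviation h B L = complex.Re ('i * endtr (B \o momentum h L)%VF).
    by rewrite endtr_momentum -[B in LHS]scale1r deviationZ mulrA mulrN -expr2
      sqrCi opprK.
  have -> : (B \o momentum h L)%VF =
      \sum_k coord e k (momentum h L) *: (B \o e`_k)%VF.
    rewrite [momentum h L in LHS](coord_vbasis (memvf _)); apply/lfunP => u.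
    rewrite comp_lfunE !sum_lfunE linear_sum; apply: eq_bigr => k _.
    by rewrite !scale_lfunE linearZ comp_lfunE.
  rewrite linear_sum mulr_sumr Re_sum; apply: eq_bigr => k _.
  rewrite linearZ /= mulrCA.
  by case: (coord _ _ _) => a b; case: ('i * _) => c d.
under eq_Rintegral do rewrite dE.
rewrite Rintegral_sum => [|k]; last exact: integrable_Rlin.
apply: big1 => k _; have [c0k1 c0k2] := c0 k.
by rewrite Rintegral_lin // c0k1 c0k2 !mul0r subrr.
Qed.

End Isotropic.

(** * Integrals of bounded functions against probabilities *)

Section AlmostSurely.
Context d (T : measurableType d) (R : realType).
Implicit Types (P : probability T R) (A B : T -> Prop).

Definition almost_surely P A := {ae P, forall x, A x}.

Lemma almost_surelyS P A B : (forall x, A x -> B x) ->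
  almost_surely P A -> almost_surely P B.
Proof. by move=> AB; apply: (@filterS _ _ (ae_filter_ringOfSetsType P)). Qed.

Lemma almost_surelyI P A B : almost_surely P A -> almost_surely P B ->
  almost_surely P (fun x => A x /\ B x).
Proof. by move=> PA PB; apply: (@filterI _ _ (ae_filter_ringOfSetsType P)). Qed.

Lemma almost_surelyP P A : measurable [set x | A x] ->
  almost_surely P A <-> P (~` [set x | A x]) = 0%E.
Proof. by move=> mA; apply: negligibleP; exact: measurableC. Qed.

Lemma almost_surely_Rintegral0 P (f : T -> R) :
    P.-integrable setT (EFin \o f) -> (forall x, 0 <= f x) ->
  \int[P]_x f x = 0 -> almost_surely P (fun x => f x = 0).
Proof.
move=> fi f0 If0.
have If : (\int[P]_x `|(f x)%:E| = 0)%E.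
  under eq_integral do rewrite gee0_abs ?lee_fin //.
  by rewrite -[LHS]fineK ?(integrable_fin_num measurableT fi) // [X in X%:E]If0.
have mf := measurable_int _ fi.
have [N [mN N0 fN]] := (ae_eq_integral_abs P measurableT mf).1 If.
exists N; split=> // x /= fx; apply: fN => /= fx0; apply: fx.
by have [] := fx0 I.
Qed.

End AlmostSurely.

Section BoundedMeasurable.
Context d (T : measurableType d) (R : realType).

Definition bounded_mfun (f : T -> R) :=
  measurable_fun setT f /\ exists M : R, forall x, `|f x| <= M.

Lemma bounded_mfun_integrable (P : probability T R) f :
  bounded_mfun f -> P.-integrable setT (EFin \o f).
Proof.
move=> [mf [M Mf]]; apply: measurable_bounded_integrable => //.
  by rewrite [X in (X < _)%E]probability_setT ltry.
exists M; split; first exact: num_real.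
by move=> x Mx y _ /=; exact: le_trans (Mf y) (ltW Mx).
Qed.

Lemma Rintegral_shift (P : probability T R) f (M : R) : bounded_mfun f ->
  \int[P]_x (f x + M) = \int[P]_x f x + M.
Proof.
move=> bf; rewrite RintegralD //; first 1 last.
- exact: bounded_mfun_integrable.
- exact: finite_measure_integrable_cst.
rewrite Rintegral_cst // [X in fine X](_ : _ = 1%E) ?mulr1 //.
exact: probability_setT.
Qed.

(** The additivity of the integral in the measure is a statement about
    nonnegative functions; adding a bound of |f| reduces to it, and the weights
    sum to 1. *)
Lemma Rintegral_mixture r (mu : probability T R)
    (nu : 'I_r.+1 -> probability T R) (c : 'I_r.+1 -> R) (f : T -> R) :
    (forall j, 0 <= c j) ->
    (forall A, measurable A -> mu A = (\sum_(j < r.+1) (c j)%:E * nu j A)%E) ->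
  bounded_mfun f -> \int[mu]_x f x = \sum_(j < r.+1) c j * \int[nu j]_x f x.
Proof.
move=> c0 muE bf; have [mf [M Mf]] := bf.
have c1 : \sum_(j < r.+1) c j = 1.
  have := muE setT measurableT; rewrite probability_setT.
  under eq_bigr do rewrite probability_setT mule1.
  by rewrite sumEFin => -[].
have fM0 x : 0 <= f x + M.
  by have := Mf x; rewrite ler_norml => /andP[+ _]; rewrite -subr_ge0 opprK.
have mfM : measurable_fun [set: T] (fun x => (f x + M)%:E).
  by apply/measurable_EFinP; apply: measurable_funD.
pose m k := mscale (NngNum (c0 (inord k))) (nu (inord k)).
(* As the weights sum to 1, shifting f by M shifts both sides by M. *)
suff : \int[mu]_x (f x + M) = \sum_(j < r.+1) c j * \int[nu j]_x (f x + M).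
  rewrite Rintegral_shift //; under eq_bigr do rewrite Rintegral_shift // mulrDr.
  by rewrite big_split /= -mulr_suml c1 mul1r => /addIr.
rewrite /Rintegral (@eq_measure_integral _ _ _ _ (msum m r.+1)); last first.
  move=> A mA _; apply: (etrans (muE A mA)); rewrite /msum; apply: eq_bigr => j _.
  by rewrite /m /mscale /= inord_val.
rewrite ge0_integral_measure_sum //; last by move=> x _; rewrite lee_fin.
have bfM : bounded_mfun (fun x => f x + M).
  split; first exact: measurable_funD.
  by exists (M + `|M|) => x; rewrite (le_trans (ler_normD _ _)) // lerD2r.
under eq_bigr => j _.
  rewrite /m ge0_integral_mscale //; last by move=> x _; rewrite lee_fin.
  rewrite inord_val /=; over.
have fi j := integrable_fin_num measurableT (bounded_mfun_integrable (nu j) bfM).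
rewrite -[RHS]/(fine _%:E) -sumEFin; congr fine.
by apply: eq_bigr => j _; rewrite EFinM fineK // fi.
Qed.

End BoundedMeasurable.

(** * Polystable means isotropic for some Hermitian product *)

Section Polystable.
Variable R : realType.
Implicit Types V W : vectType R[i].

Lemma bounded_mfun_rayleigh V (h : {dot V for Num.conj}) B :
  bounded_mfun (rayleigh h B : projB V -> R).
Proof.
by split; [exact: measurable_rayleigh|exact: rayleigh_bounded].
Qed.

Lemma Rintegral_distribution d d' (T : measurableType d) (T' : measurableType d')
    (P : probability T R) (X : {mfun T >-> T'}) (f : T' -> R) :
  bounded_mfun f -> \int[distribution P X]_y f y = \int[P]_x f (X x).
Proof.
move=> [mf [M Mf]]; rewrite /Rintegral integral_distribution //.
  exact/measurable_EFinP.
apply: (@bounded_mfun_integrable _ _ _ P (f \o X)); split.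
  exact: measurableT_comp.
by exists M => x; exact: Mf.
Qed.

Lemma rayleigh_proportional V (h h' : {dot V for Num.conj}) (c : R[i]) B L :
  0 < c -> (forall u v, h u v = c * h' u v) -> rayleigh h B L = rayleigh h' B L.
Proof.
move=> c0 hh'; rewrite /rayleigh !hh'; congr complex.Re.
by rewrite -mulf_div divff ?mul1r // gt_eqF.
Qed.

(** Comparing Rayleigh quotients on both sides of an injective map requires
    endomorphisms intertwined by that map. *)
Lemma rayleigh_pull V W (h : {dot W for Num.conj}) (f : 'Hom(V, W))
    (f0 : lker f == 0%VS) (B : 'End(W)) (B' : 'End(V)) (L : proj V) :
    fullv != 0%VS :> {vspace V} -> (forall v, B (f v) = f (B' v)) ->
  rayleigh h B (projmap f L) = rayleigh (dot_pull h f0) B' L.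
Proof.
move=> V0 BB'; have [z0 ->] := pline_surj L V0.
have fz0 : f (vpick (val L)) != 0.
  by apply: contra z0 => /eqP fz; apply/eqP/(lker0P f0); rewrite fz linear0.
by rewrite projmap_pline // !rayleigh_pline // /dot_pull BB'.
Qed.

Lemma isotropic_push V (h : {dot V for Num.conj}) (g : SL V) nu :
    fullv != 0%VS :> {vspace V} ->
  isotropic h (SL_push g nu) <-> isotropic (dot_pull h (lker_SL g)) nu.
Proof.
move=> V0; have g0 := lker_SL g.
have intE (B B' : 'End(V)) : (forall v, B (val g v) = val g (B' v)) ->
    \int[SL_push g nu]_L rayleigh h B L =
    \int[nu]_L rayleigh (dot_pull h (lker_SL g)) B' L.
  move=> BB'; rewrite Rintegral_distribution; last exact: bounded_mfun_rayleigh.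
  by apply: eq_Rintegral => L _; exact: rayleigh_pull.
split=> iso B.
  rewrite -(intE (val g \o B \o (val g)^-1)%VF); last first.
    by move=> v; rewrite !comp_lfunE lker0_lfunK.
  by rewrite iso endtr_comp comp_lfunA lker0_compVf // comp_lfun1l.
rewrite (intE _ ((val g)^-1 \o B \o val g)%VF); last first.
  by move=> v; rewrite !comp_lfunE lker0_lfunVK.
by rewrite iso endtr_comp comp_lfunA lker0_compfV // comp_lfun1l.
Qed.

Lemma isotropic_proportional V (h h' : {dot V for Num.conj}) (c : R[i]) nu :
  0 < c -> (forall u v, h u v = c * h' u v) -> isotropic h nu <-> isotropic h' nu.
Proof.
move=> c0 hh'; split=> iso B; rewrite -iso; apply: eq_Rintegral => L _.
  exact/esym/(rayleigh_proportional _ _ c0).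
exact/(rayleigh_proportional _ _ c0).
Qed.

(** Moving the measure by g amounts to pulling the Hermitian product back
    along g. Every Hermitian product arises in this way from h, up to a factor,
    and Rayleigh quotients do not see the factor. *)
Lemma polystable_isotropic V (h : {dot V for Num.conj}) nu :
    fullv != 0%VS :> {vspace V} ->
  polystable h nu <-> exists h' : {dot V for Num.conj}, isotropic h' nu.
Proof.
move=> V0; split=> [[g /frakF_eq0 /(isotropic_push _ _ _ V0) iso]|[h' iso]].
  by eexists; exact: iso.
have [g [c [c0 hh']]] := dot_equiv h h'.
exists g; apply/frakF_eq0/isotropic_push => //.
by apply/(isotropic_proportional _ c0); last exact: iso.
Qed.

End Polystable.

(** * Irreducible measures are isotropic for one product only *)

Section Rigidity.
Variables (R : realType) (V : vectType R[i]).
Hypothesis V0 : fullv != 0%VS :> {vspace V}.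
Implicit Types (h : {dot V for Num.conj}) (nu : probability (projB V) R).

(** No Hermitian product enters, so the notion can be used for two of them at
    once. *)
Definition irreducible nu := forall W1 W2 : {vspace V},
  (W1 + W2 = fullv)%VS -> (W1 :&: W2 = 0)%VS ->
  almost_surely nu (fun L => subproj W1 L \/ subproj W2 L) ->
  W1 = 0%VS \/ W2 = 0%VS.

Section Comparison.
Variables (h h' : {dot V for Num.conj}) (S : 'End(V)).
Hypothesis hS : forall u v, h (S u) v = h' u v.

Lemma comparison_selfadjoint u v : h (S u) v = h u (S v).
Proof. by rewrite hS dotC -hS -dotC. Qed.

(** The heart of the rigidity argument. The left-hand side compares the two
    isotropy conditions tested on S itself; the right-hand side shows that it is
    the squared norm of the component of S z orthogonal to z, up to a positive
    factor, hence nonnegative, and zero exactly on the eigenlines of S. It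
    replaces the convexity of the Kempf-Ness function. *)
Lemma rayleigh_comparison z : z != 0 ->
  let w := S z - (h (S z) z / h z z) *: z in
  h' (S z) z / h' z z - h (S z) z / h z z = h w w / h' z z.
Proof.
move=> z0 /=; set a := h (S z) z / h z z.
have hz : h z z != 0 by rewrite dnorm_eq0.
have h'z : h' z z != 0 by rewrite dnorm_eq0.
have aE : a = h' z z / h z z by rewrite /a hS.
have a_real : Num.conj a = a.
  by rewrite aE; apply: CrealP; rewrite rpredM ?rpredV ?dot_real.
have hSz : h z (S z) = h' z z by rewrite -comparison_selfadjoint hS.
have h'S : h' (S z) z = h (S z) (S z) by rewrite -hS comparison_selfadjoint.
have -> : h (S z - a *: z) (S z - a *: z) = h (S z) (S z) - a * h' z z.
  have hw k : Num.conj k = k -> h (S z - k *: z) (S z - k *: z) =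
      h (S z) (S z) - k * h (S z) z - (k * h z (S z) - k * (k * h z z)).
    move=> kk; rewrite linearBl /= !linearBr /= !linearZl_LR.
    by rewrite !linearZr_LR /= kk.
  by rewrite hw // hSz !hS aE divfK // subrr subr0.
by rewrite h'S -/a mulrBl mulfK.
Qed.

Lemma comparison_ge0 (L : proj V) : 0 <= rayleigh h' S L - rayleigh h S L.
Proof.
have [z0 ->] := pline_surj L V0; rewrite !rayleigh_pline // -ReB.
by rewrite rayleigh_comparison // -ler0c RRe_real ?ger0_real // divr_ge0 ?dnorm_ge0.
Qed.

Lemma comparison_eq0 (L : proj V) : rayleigh h' S L - rayleigh h S L = 0 ->
  exists k, S (vpick (val L)) = k *: vpick (val L).
Proof.
have [z0 {1 2}->] := pline_surj L V0; set z := vpick _.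
rewrite !rayleigh_pline // -ReB rayleigh_comparison //; set w := S z - _.
have w0 : 0 <= h w w / h' z z by rewrite divr_ge0 ?dnorm_ge0.
move=> /(congr1 (fun x => x%:C%C)); rewrite RRe_real ?ger0_real // => /eqP.
rewrite mulf_eq0 invr_eq0 !dnorm_eq0 (negbTE z0) orbF subr_eq0 => /eqP wz.
by eexists; exact: wz.
Qed.

(** Both isotropy conditions give the same value, the trace of S over the
    dimension, so the nonnegative difference of the two integrands has integral
    zero. *)
Lemma isotropic_eigenlines nu : isotropic h nu -> isotropic h' nu ->
  almost_surely nu (fun L => exists k, S (vpick (val L)) = k *: vpick (val L)).
Proof.
move=> iso iso'.
pose f (L : projB V) : R := rayleigh h' S L - rayleigh h S L.
have fi : nu.-integrable setT (EFin \o f).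
  apply: (eq_integrable measurableT ((EFin \o (rayleigh h' S : projB V -> R)) \-
     (EFin \o (rayleigh h S : projB V -> R)))%E) => //.
  by apply: integrableB => //; exact: integrable_rayleigh.
apply: almost_surelyS (almost_surely_Rintegral0 fi comparison_ge0 _).
  by move=> L; exact: comparison_eq0.
rewrite RintegralB //; first 1 last.
- exact: integrable_rayleigh.
- exact: integrable_rayleigh.
by rewrite iso iso' subrr.
Qed.

(** For an eigenvalue c of S, almost every line is an eigenline of S and so lies
    in ker (S - c) or in im (S - c). These two subspaces split V because S is
    self-adjoint, so irreducibility forces S = c. *)
Lemma isotropic_unique nu : irreducible nu ->
    isotropic h nu -> isotropic h' nu ->
  exists2 c : R[i], 0 < c & forall u v, h' u v = c * h u v.
Proof.
move=> irr iso iso'; have eigS := isotropic_eigenlines iso iso'.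
set e := vbasis {:V}; have eB : basis_of {:V} e := vbasisP _.
have N0 : (0 < \dim {:V})%N by rewrite lt0n dimv_eq0.
have [c /eigenvalueP [x xS x0]] := eigenvalue_closed (mxof e e S) N0.
pose v := vecof e x; have v0 : v != 0 by rewrite vecof_eq0.
have Sv : S v = c *: v by rewrite (hom_vecof _ eB) xS linearZ.
have cE : c = h' v v / h v v by rewrite -hS Sv linearZl_LR /= mulfK ?dnorm_eq0.
have c_gt0 : 0 < c by rewrite cE divr_gt0 // dot_gt0.
(* The kernel and the image of S - c are to split V. *)
pose T : 'End(V) := S - c *: \1%VF.
have TE u : T u = S u - c *: u by rewrite add_lfunE opp_lfunE scale_lfunE id_lfunE.
have Tsym u w : h (T u) w = h u (T w).
  rewrite !TE linearBl linearBr /= linearZl_LR linearZr_LR /= comparison_selfadjoint.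
  by rewrite (CrealP (gtr0_real c_gt0)).
have KI : (lker T :&: limg T = 0)%VS.
  apply/eqP; rewrite -subv0; apply/subvP => u; rewrite memv_cap memv_ker memv0.
  move=> /andP[/eqP Tu /memv_imgP[w _ uE]].
  by rewrite -(dnorm_eq0 h) {1}uE Tsym Tu linear0r.
have KIV : (lker T + limg T = fullv)%VS.
  apply/eqP; rewrite eqEdim subvf dimv_disjoint_sum //.
  by rewrite -(limg_ker_dim T fullv) capfv leqnn.
have [|K0|I0] := irr _ _ KIV KI.
- apply: almost_surelyS eigS => L [k Sz].
  have [z0 LE] := pline_surj L V0; rewrite LE !subproj_pline //.
  have [kc|kc] := eqVneq k c; first by left; rewrite memv_ker TE Sz kc subrr.
  right; apply/memv_imgP; exists ((k - c)^-1 *: vpick (val L)); first exact: memvf.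
  by rewrite linearZ /= TE Sz -scalerBl scalerA mulVf ?scale1r // subr_eq0.
- have : v \in lker T by rewrite memv_ker TE Sv subrr.
  by rewrite K0 memv0 (negbTE v0).
exists c => // u w; rewrite -hS; have : T u \in limg T by apply: memv_img; exact: memvf.
by rewrite I0 memv0 TE subr_eq0 => /eqP ->; rewrite linearZl_LR.
Qed.

End Comparison.

(** Taking determinants of Gram matrices gives c ^ dim V = 1. *)
Lemma dot_scale_det h (g : SL V) (c : R[i]) : 0 < c ->
  (forall u v, h (val g u) (val g v) = c * h u v) -> c = 1.
Proof.
move=> c0 hg; set e := vbasis {:V}; have eB : basis_of {:V} e := vbasisP _.
have N0 : (0 < \dim {:V})%N by rewrite lt0n dimv_eq0.
pose E := \matrix_(i < \dim {:V}, j < \dim {:V}) h e`_i e`_j.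
pose M := mxof e e (val g).
have gE (i : 'I_(\dim {:V})) : val g e`_i = \sum_j M i j *: e`_j.
  rewrite -vecof_delta (hom_vecof _ eB) /vecof; apply: eq_bigr => j _.
  by rewrite -rowE mxE.
have dM : \det M = 1 by exact/eqP/(valP g).
clearbody M.
have ME : M *m E *m map_mx Num.conj M^T = c *: E.
  apply/matrixP => i j; rewrite !mxE -hg !gE linear_sumr /=.
  apply: eq_bigr => k _; rewrite linearZr_LR /= !mxE mulrC linear_sumlz.
  by congr (_ * _); apply: eq_bigr => l _; rewrite linearZl_LR /= mxE.
have E0 : \det E != 0.
  rewrite -unitfE -unitmxE -row_free_unit -kermx_eq0; apply/rowV0P => v /sub_kermxP vE.
  apply/eqP; rewrite -(vecof_eq0 eB) -(dnorm_eq0 h) {2}/vecof linear_sumr big1 // => j _.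
  have vEj : \sum_i h (v 0 i *: e`_i) e`_j = 0.
    transitivity ((v *m E) 0 j); last by rewrite vE mxE.
    by rewrite mxE; apply: eq_bigr => i _; rewrite linearZl_LR mxE.
  by rewrite linearZr_LR /= linear_sumlz vEj mulr0.
have := congr1 determinant ME; rewrite !det_mulmx detZ det_map_mx det_tr.
rewrite dM rmorph1 mul1r mulr1 => /esym/eqP.
rewrite -subr_eq0 -[X in _ - X]mul1r -mulrBl mulf_eq0 (negbTE E0) orbF subr_eq0.
by rewrite pexpr_eq1 ?ltW // => /eqP.
Qed.

Lemma stabilizer_unitary h nu (g : SL V) : irreducible nu -> isotropic h nu ->
  SL_stab nu g -> forall u v, h (val g u) (val g v) = h u v.
Proof.
move=> irr iso gnu.
have iso' : isotropic (dot_pull h (lker_SL g)) nu.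
  apply/(isotropic_push h g nu V0) => B; rewrite -iso /Rintegral.
  congr fine.
  have E (m1 m2 : {measure set (projB V) -> \bar R}) (f : projB V -> \bar R) :
      (forall A, measurable A -> m1 A = m2 A) -> (\int[m1]_x f x = \int[m2]_x f x)%E.
    by move=> m12; apply: eq_measure_integral => A mA _; exact: m12.
  apply: E; exact: gnu.
have [S hS] := dot_represent h (psi := dot_pull h (lker_SL g)) (dot_pull_bilinear _ _).
have [c c0 hc] := isotropic_unique hS irr iso iso'.
by have c1 := dot_scale_det c0 hc; move=> u v; have := hc u v; rewrite c1 mul1r.
Qed.

End Rigidity.

(** * Tangent sequences *)

Section Tangency.
Variables (K : numClosedFieldType) (t : nat -> K).
Hypothesis t_gt0 : forall m, 0 < t m.
Hypothesis t_le1 : forall m, t m <= 1.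
Hypothesis t_small : forall x B : K, (forall m, `|x| <= B * t m) -> x = 0.
Implicit Types u v : nat -> K.

(** Bounded sequences that agree up to O(t^2). Taking t to be a null sequence,
    this is equality of first-order expansions at 0, and it only involves
    inequalities. *)
Definition tangent u v := exists B : K, forall m,
  [/\ `|u m| <= B, `|v m| <= B & `|u m - v m| <= B * t m ^+ 2].

Let t2_ge0 m : 0 <= t m ^+ 2. Proof. by rewrite exprn_ge0 // ltW. Qed.

Lemma eq_tangent u v u' v' : u =1 u' -> v =1 v' ->
  tangent u v -> tangent u' v'.
Proof. by move=> /funext <- /funext <-. Qed.

Lemma tangent_cst (a : K) : tangent (fun=> a) (fun=> a).
Proof.
by exists `|a| => m; split=> //; rewrite subrr normr0 mulr_ge0.
Qed.

Lemma tangentD u v u' v' : tangent u v -> tangent u' v' ->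
  tangent (fun m => u m + u' m) (fun m => v m + v' m).
Proof.
move=> [B H] [B' H']; exists (B + B') => m.
have [uB vB uv] := H m; have [uB' vB' uv'] := H' m; split.
- by rewrite (le_trans (ler_normD _ _)) // lerD.
- by rewrite (le_trans (ler_normD _ _)) // lerD.
by rewrite opprD addrACA mulrDl (le_trans (ler_normD _ _)) // lerD.
Qed.

Lemma tangentM u v u' v' : tangent u v -> tangent u' v' ->
  tangent (fun m => u m * u' m) (fun m => v m * v' m).
Proof.
move=> [B H] [B' H']; exists (B * B' + B * B') => m.
have [uB vB uv] := H m; have [uB' vB' uv'] := H' m.
have B0 : 0 <= B by exact: le_trans uB.
have B'0 : 0 <= B' by exact: le_trans uB'.
have BB0 : 0 <= B * B' by exact: mulr_ge0.
split.
- by rewrite normrM ler_wpDr // ler_pM.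
- by rewrite normrM ler_wpDr // ler_pM.
have -> : u m * u' m - v m * v' m = (u m - v m) * u' m + v m * (u' m - v' m) by ring.
rewrite [X in _ <= X]mulrDl (le_trans (ler_normD _ _)) // lerD // normrM.
  by rewrite mulrAC ler_pM.
by rewrite -mulrA ler_pM.
Qed.

Lemma tangent_conj u v : tangent u v ->
  tangent (fun m => Num.conj (u m)) (fun m => Num.conj (v m)).
Proof.
move=> [B H]; exists B => m; have [uB vB uv] := H m.
by rewrite -rmorphB !norm_conjC.
Qed.

Lemma tangent_sum (I : Type) (r : seq I) (F G : I -> nat -> K) :
  (forall i, tangent (F i) (G i)) ->
  tangent (fun m => \sum_(i <- r) F i m) (fun m => \sum_(i <- r) G i m).
Proof.
move=> FG; elim: r => [|i r IH].
  have [B H] := tangent_cst 0; exists B => m; rewrite !big_nil; exact: H.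
have [B H] := tangentD (FG i) IH; exists B => m; rewrite !big_cons; exact: H.
Qed.

Lemma tangent_prod (I : Type) (r : seq I) (F G : I -> nat -> K) :
  (forall i, tangent (F i) (G i)) ->
  tangent (fun m => \prod_(i <- r) F i m) (fun m => \prod_(i <- r) G i m).
Proof.
move=> FG; elim: r => [|i r IH].
  have [B H] := tangent_cst 1; exists B => m; rewrite !big_nil; exact: H.
have [B H] := tangentM (FG i) IH; exists B => m; rewrite !big_cons; exact: H.
Qed.

Lemma tangent_mulmx m n p (U : 'M[K]_(m, n)) (F G : nat -> 'M[K]_(n, p)) i j :
  (forall k, tangent (fun l => F l k j) (fun l => G l k j)) ->
  tangent (fun l => (U *m F l) i j) (fun l => (U *m G l) i j).
Proof.
move=> FG; apply: (@eq_tangent (fun l => \sum_k U i k * F l k j)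
  (fun l => \sum_k U i k * G l k j)) => [l|l|]; rewrite ?mxE //.
by apply: tangent_sum => k; apply: tangentM; [exact: tangent_cst|exact: FG].
Qed.

Lemma tangent_det n (U W : nat -> 'M[K]_n) :
  (forall i j, tangent (fun m => U m i j) (fun m => W m i j)) ->
  tangent (fun m => \det (U m)) (fun m => \det (W m)).
Proof.
move=> UW; apply: tangent_sum => s.
by apply: tangentM; [exact: tangent_cst|exact: tangent_prod].
Qed.

(** A sequence tangent to a constant has no first-order term, since b is then
    bounded by a multiple of every t m. *)
Lemma tangent_derivative u (a b B : K) :
    tangent (fun=> a) u ->
    (forall m, `|u m - (a + b * t m)| <= B * t m ^+ 2) -> b = 0.
Proof.
move=> [D H] uB; apply: (t_small (B := D + B)) => m.
have [_ _ au] := H m.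
rewrite -(ler_pM2r (t_gt0 m)) -{1}[t m]gtr0_norm // -normrM -mulrA -expr2.
have -> : b * t m = (u m - a) - (u m - (a + b * t m)) by ring.
by rewrite mulrDl (le_trans (ler_normB _ _)) // lerD // distrC.
Qed.

(** det (1 + t A) is t^n times the characteristic polynomial of -A at 1/t, so its
    first two coefficients are 1 and tr A. *)
Lemma det1D_expansion n (A : 'M[K]_n) : exists B : K, forall m,
  `|\det (1%:M + t m *: A) - (1 + \tr A * t m)| <= B * t m ^+ 2.
Proof.
case: n A => [|n] A.
  by exists 0 => m; rewrite det_mx00 /mxtrace big_ord0 mul0r addr0 subrr normr0 mul0r.
pose p := char_poly (- A).
have pE m : \det (1%:M + t m *: A) = \sum_(k < n.+2) p`_k * t m ^+ (n.+1 - k).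
  have t0 : t m != 0 by rewrite gt_eqF.
  have -> : 1%:M + t m *: A = t m *: map_mx (horner_eval (t m)^-1) (char_poly_mx (- A)).
    apply/matrixP => i j; rewrite !mxE /horner_eval !hornerE.
    rewrite hornerMn hornerX mulrDr mulrnAr mulfV //; ring.
  have dE : \det (map_mx (horner_eval (t m)^-1) (char_poly_mx (- A))) = p.[(t m)^-1].
    exact: det_map_mx.
  rewrite detZ dE horner_coef size_char_poly mulr_sumr; apply: eq_bigr => k _.
  by rewrite mulrCA exprVn -expfB_cond // (negbTE t0) add0n -ltnS.
have pn : p`_n.+1 = 1.
  have := char_poly_monic (- A); rewrite monicE lead_coefE size_char_poly.
  by move=> /eqP.
have pn1 : p`_n = \tr A by rewrite (char_poly_trace (- A)) // linearN opprK.
exists (\sum_(k < n) `|p`_k|) => m.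
rewrite pE big_ord_recr big_ord_recr /= pn pn1 subSnn subnn expr1 expr0 mulr1.
rewrite -addrA [X in _ - X]addrC addrK mulr_suml.
apply: le_trans (ler_norm_sum _ _ _) _; apply: ler_sum => k _.
rewrite normrM ler_wpM2l // normrX gtr0_norm //.
by rewrite ler_wiXn2l ?(ltW (t_gt0 m)) // subSn ?ltnS ?subn_gt0 // ltnW.
Qed.

(** Comparing M with 1 + t A, the determinant 1 has the first-order term tr A. *)
Lemma tangent_trace0 n (A : 'M[K]_n) (M : nat -> 'M[K]_n) :
    (forall i j, tangent (fun m => M m i j) (fun m => (1%:M + t m *: A) i j)) ->
  (forall m, \det (M m) = 1) -> \tr A = 0.
Proof.
move=> MA M1; have [B HB] := det1D_expansion A.
apply: tangent_derivative HB; have [D H] := tangent_det MA.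
by exists D => m; have := H m; rewrite M1.
Qed.

End Tangency.

(** * The exponential to first order *)

Section Exponential.
Variable R : realType.

Lemma matrix_point0 n : (point : 'M[R[i]]_n) = 0.
Proof.
have -> : (point : 'M[R[i]]_n) = \matrix_(_, _) (point : R[i]) by [].
by apply/matrixP => i j; rewrite !mxE.
Qed.

(** The limit of a divergent sequence is the default matrix 0. A nonzero value,
    for instance an invertible one, therefore certifies convergence; this is how
    the exponential series is known to converge. *)
Lemma lim_neq0_cvg n (u : nat -> 'M[R[i]]_n) : limn u != 0 ->
  u @ \oo --> limn u.
Proof.
move=> u0; apply: contrapT => du; move/eqP: u0; apply.
rewrite -matrix_point0 /lim /lim_in /=; apply: getPN => l ul.
by apply: du; apply/cvg_ex; exists l.
Qed.

Lemma lim_neq0_dist n (u : nat -> 'M[R[i]]_n) (i j : 'I_n) (e : R[i]) :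
  limn u != 0 -> 0 < e ->
  exists k0, forall k, (k0 <= k)%N -> `|(limn u) i j - u k i j| < e.
Proof.
move=> /lim_neq0_cvg ul e0; set l := limn u in ul *.
have : nbhs l [set M : 'M[R[i]]_n | `|l i j - M i j| < e].
  have H : M i j @[M --> l] --> l i j by exact: coord_continuous.
  by have /(@cvgrPdist_lt _ _ _ (nbhs l)) := H; apply.
by move=> /ul [k0 _ H]; exists k0 => k kk; exact: H.
Qed.

(** The index is shifted so that all the parameters are at most 1/2, where the
    geometric series is bounded by 2. *)
Definition step (m : nat) : R := m.+2%:R^-1.
Local Notation t m := ((step m)%:C%C : R[i]).

Lemma step_gt0 m : 0 < t m.
Proof. by rewrite ltcR invr_gt0. Qed.

Lemma step_half m : t m + t m <= 1.
Proof.
rewrite -rmorphD /= -[1]/(1%:C%C) lecR -mulr2n -mulr_natr.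
by rewrite mulrC ler_pdivrMr // mul1r ler_nat.
Qed.

Lemma step_le1 m : t m <= 1.
Proof.
by apply: le_trans (step_half m); rewrite lerDl ltW ?step_gt0.
Qed.

Lemma step_small (x B : R[i]) : (forall m, `|x| <= B * t m) -> x = 0.
Proof.
move=> H; apply/eqP; rewrite -normr_eq0; apply: contraT => x0.
have nx : 0 < `|x| by rewrite lt_def x0 normr_ge0.
have Bp : 0 < B by have := lt_le_trans nx (H 0%N); rewrite pmulr_lgt0 ?step_gt0.
have xE : `|x| / B = (complex.Re (`|x| / B))%:C%C.
  by rewrite RRe_real // ger0_real // divr_ge0 // ltW.
have e0 : 0 < complex.Re (`|x| / B) by rewrite -ltcR -xE divr_gt0.
have [k _ kP] := near_infty_natSinv_lt (PosNum e0).
have := kP k.+1 (leqnSn k); rewrite /= -ltcR -xE ltr_pdivlMr // mulrC.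
by move=> /lt_le_trans /(_ (H k)); rewrite ltxx.
Qed.

Lemma geometric_half m k : \sum_(i < k) t m ^+ i <= 2%:R.
Proof.
suff H : \sum_(i < k) t m ^+ i <= 2%:R - (t m ^+ k + t m ^+ k).
  apply: le_trans H _; rewrite gerBl addr_ge0 // exprn_ge0 // ltW ?step_gt0 //.
elim: k => [|k IH]; first by rewrite big_ord0 expr0 subrr.
rewrite big_ord_recr /=; apply: le_trans (lerD IH (lexx _)) _.
rewrite opprD addrA subrK lerD2l lerN2.
rewrite exprS -mulrDl ler_piMl ?step_half // exprn_ge0 // ltW ?step_gt0 //.
Qed.

(** Two consecutive partial sums that are close to l differ by a small term. *)
Lemma bounded_tail (a : nat -> R[i]) (l : R[i]) (k0 : nat) :
  (forall k, (k0 <= k)%N -> `|l - \sum_(i < k) a i| < 1) ->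
  exists K, 0 <= K /\ forall k, `|a k| <= K.
Proof.
move=> H; exists (\sum_(i < k0) `|a i| + 2%:R); split.
  by rewrite addr_ge0 // sumr_ge0.
move=> k; have [kk|kk] := ltnP k k0.
  by rewrite (bigD1 (Ordinal kk)) //= -addrA lerDl addr_ge0 // sumr_ge0.
rewrite -[X in X <= _]add0r lerD ?sumr_ge0 //.
have -> : a k = (l - \sum_(i < k) a i) - (l - \sum_(i < k.+1) a i).
  by rewrite big_ord_recr /=; ring.
rewrite (le_trans (ler_normB _ _)) // (_ : 2%:R = 1 + 1) // ?lerD //.
  by rewrite ltW ?H.
by rewrite ltW ?H // ltnW.
Qed.

(** Convergence at 1 bounds the coefficients by some K, and then the terms of
    order at least 2 at t <= 1/2 add up to at most 2 K t^2. *)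
Lemma power_series_tangent (a : nat -> R[i]) (f : R -> R[i]) :
    (forall (s : R) (e : R[i]), 0 < e -> exists k0, forall k, (k0 <= k)%N ->
      `|f s - \sum_(i < k) s%:C%C ^+ i * a i| < e) ->
  tangent (fun m => t m) (fun m => f (step m)) (fun m => a 0%N + t m * a 1%N).
Proof.
move=> fa.
have [k0 H1] := fa 1 1 ltr01.
have [|K [K0 aK]] := @bounded_tail a (f 1) k0.
  move=> k /H1; congr (_ < _); congr (`|_ - _|); apply: eq_bigr => i _.
  by rewrite rmorph1 expr1n mul1r.
(* The bound serves both the values and the second-order remainder. *)
pose B := `|a 0%N| + `|a 1%N| + (2%:R * K + 1).
have fB m : `|f (step m) - (a 0%N + t m * a 1%N)| <= (2%:R * K + 1) * t m ^+ 2.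
  have t0 := step_gt0 m.
  have [k1 Hk] := fa (step m) (t m ^+ 2) (exprn_gt0 2 t0).
  have := Hk (k1.+2) (leq_trans (leqnSn _) (leqnSn _)).
  rewrite big_ord_recl big_ord_recl /= expr0 mul1r expr1 addrA.
  set T := \sum_(i < k1) _ => HT.
  have T_le : `|T| <= 2%:R * K * t m ^+ 2.
    apply: le_trans (ler_norm_sum _ _ _) _.
    apply: (@le_trans _ _ (\sum_(i < k1) t m ^+ i * (K * t m ^+ 2))).
      apply: ler_sum => i _; rewrite normrM normrX gtr0_norm //.
      rewrite (_ : bump 0 (bump 0 i) = (i + 2)%N); last by rewrite /bump !add1n addn2.
      by rewrite exprD -mulrA ler_wpM2l ?exprn_ge0 ?(ltW t0) // mulrC ler_wpM2r
        ?exprn_ge0 ?(ltW t0).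
    rewrite -mulr_suml -[in X in _ <= X]mulrA ler_wpM2r ?geometric_half //.
    by rewrite mulr_ge0 // exprn_ge0 // ltW.
  have -> : f (step m) - (a 0%N + t m * a 1%N) =
      (f (step m) - (a 0%N + t m * a 1%N + T)) + T by ring.
  by rewrite (le_trans (ler_normD _ _)) // addrC mulrDl mul1r lerD // ltW.
have t2 m : t m ^+ 2 <= 1 by rewrite exprn_ile1 ?step_le1 // ltW ?step_gt0.
have K1 : 0 <= 2%:R * K + 1 by rewrite addr_ge0 // mulr_ge0.
have vB m : `|a 0%N + t m * a 1%N| <= `|a 0%N| + `|a 1%N|.
  rewrite (le_trans (ler_normD _ _)) // lerD2l normrM gtr0_norm ?step_gt0 //.
  by rewrite ler_piMl ?step_le1.
exists B => m; split.
- rewrite -[f _](subrK (a 0%N + t m * a 1%N)) (le_trans (ler_normD _ _)) // addrC.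
  by rewrite lerD // (le_trans (fB m)) // ler_piMr.
- by rewrite (le_trans (vB m)) // lerDl.
apply: le_trans (fB m) _; rewrite ler_wpM2r ?exprn_ge0 ?(ltW (step_gt0 _)) //.
by rewrite lerDr addr_ge0.
Qed.

Lemma expmxZ n (c : R[i]) (X : 'M[R[i]]_n) k :
  (c *: X) ^+ k = c ^+ k *: X ^+ k.
Proof.
elim: k => [|k IH]; first by rewrite !expr0 scale1r.
rewrite !exprS IH -[LHS]/((c *: X) *m (c ^+ k *: X ^+ k)).
by rewrite -scalemxAl -scalemxAr scalerA.
Qed.

Lemma matrix_exp_tangent n (X : 'M[R[i]]_n) (M : R -> 'M[R[i]]_n) :
    (forall s, M s = limn (series (fun k => (k`!%:R : R[i])^-1 *: (s%:C%C *: X) ^+ k))) ->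
    (forall s, M s != 0) -> forall i j,
  tangent (fun m => t m) (fun m => M (step m) i j)
    (fun m => (1%:M + t m *: X) i j).
Proof.
move=> ME M0 i j.
pose a k := (k`!%:R : R[i])^-1 * (X ^+ k) i j.
have H := @power_series_tangent a (fun s => M s i j).
have vE m : (1%:M + t m *: X) i j = a 0%N + t m * a 1%N.
  by rewrite !mxE /a expr0 expr1 fact0 invr1 !mul1r mxE.
have [|B HB] := H; last by exists B => m; rewrite vE; exact: HB.
move=> s e e0.
have [k0 Hk] : exists k0, forall k, (k0 <= k)%N ->
   `|M s i j - series (fun k => (k`!%:R : R[i])^-1 *: (s%:C%C *: X) ^+ k) k i j| < e.
  by rewrite ME; apply: lim_neq0_dist => //; rewrite -ME.
exists k0 => k kk; have := Hk k kk; congr (_ < _); congr (`|_ - _|).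
rewrite /series /= big_mkord summxE; apply: eq_bigr => l _.
by rewrite expmxZ scalerA mxE /a mulrCA mulrA.
Qed.

End Exponential.

(** * Unitary one-parameter groups of determinant one *)

Section OneParameter.
Variables (R : realType) (V : vectType R[i]).
Hypothesis V0 : fullv != 0%VS :> {vspace V}.
Local Notation e := (vbasis {:V}).
Local Notation t m := ((step R m)%:C%C : R[i]).

Lemma dot_vecof (h : {dot V for Num.conj}) (x y : 'rV[R[i]]_(\dim {:V})) :
  h (vecof e x) (vecof e y) =
    \sum_k \sum_l x 0 k * (Num.conj (y 0 l) * h e`_k e`_l).
Proof.
rewrite {1}/vecof linear_sumlz; apply: eq_bigr => k _; rewrite /vecof linear_sumr.
by apply: eq_bigr => l _; rewrite linearZr_LR linearZl_LR /= mulrCA.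
Qed.

Lemma tangent_dot_vecof (h : {dot V for Num.conj}) (s : nat -> R[i])
    (x y x' y' : nat -> 'rV[R[i]]_(\dim {:V})) :
    (forall m, 0 < s m) ->
    (forall k, tangent s (fun m => x m 0 k) (fun m => x' m 0 k)) ->
    (forall k, tangent s (fun m => y m 0 k) (fun m => y' m 0 k)) ->
  tangent s (fun m => h (vecof e (x m)) (vecof e (y m)))
            (fun m => h (vecof e (x' m)) (vecof e (y' m))).
Proof.
move=> s0 xx yy.
apply: (eq_tangent (fun m => esym (dot_vecof h (x m) (y m)))
                   (fun m => esym (dot_vecof h (x' m) (y' m)))).
apply: tangent_sum => // k; apply: tangent_sum => // l.
apply: tangentM; first exact: xx.
by apply: tangentM; [apply/tangent_conj/yy|exact: tangent_cst].
Qed.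

(** Compare exp(tA) with 1 + tA for small t. The first-order term of
    h(exp(tA) u, exp(tA) v) vanishes, which says that A is skew, and so does that
    of det exp(tA), which is tr A. *)
Lemma unitary_one_parameter_su (h : {dot V for Num.conj}) (A : 'End(V)) :
    (forall s : R, exists2 g : SL V, val g = expEnd (s%:C%C *: A) &
       forall u v, h (val g u) (val g v) = h u v) ->
  su h A.
Proof.
move=> gA; have eB : basis_of {:V} e := vbasisP _.
have N0 : (0 < \dim {:V})%N by rewrite lt0n dimv_eq0.
pose X := mxof e e A; pose M (s : R) := mxof e e (expEnd (s%:C%C *: A)).
have ME s : M s =
    limn (series (fun k => (k`!%:R : R[i])^-1 *: (s%:C%C *: X) ^+ k)).
  have XE : mxof e e (s%:C%C *: A) = s%:C%C *: X by exact: linearZ.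
  by rewrite /M /expEnd (hommxK eB eB) XE.
have Mdet s : \det (M s) = 1.
  by have [g gE _] := gA s; rewrite /M -gE; exact/eqP/(valP g).
have M0 s : M s != 0.
  apply/eqP => Ms0; have := Mdet s; rewrite Ms0 -(scale0r 0) detZ expr0n.
  by rewrite eqn0Ngt N0 mul0r => /esym/eqP; rewrite oner_eq0.
have MX := matrix_exp_tangent ME M0.
have t_small := @step_small R.
split; last exact: (tangent_trace0 (@step_gt0 R) (@step_le1 R) t_small MX).
move=> u v; apply/eqP; rewrite -addr_eq0; apply/eqP.
apply: (tangent_derivative (@step_gt0 R) t_small (a := h u v)
  (u := fun m => h (u + t m *: A u) (v + t m *: A v))
  (B := `|h (A u) (A v)|)); last first.
  have hE (k : R[i]) : Num.conj k = k -> h (u + k *: A u) (v + k *: A v) =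
      h u v + (h (A u) v + h u (A v)) * k + h (A u) (A v) * k ^+ 2.
    move=> kk.
    have hr w w' : h w (k *: w') = k * h w w' by rewrite linearZr_LR /= kk.
    have hl w w' : h (k *: w) w' = k * h w w' by rewrite linearZl_LR.
    by rewrite linearDl /= !linearDr /= !hr !hl; ring.
  move=> m; rewrite hE; last by apply/CrealP; rewrite gtr0_real ?step_gt0.
  rewrite [_ + _ * t m + _]addrC addrK.
  by rewrite normrM normrX (gtr0_norm (@step_gt0 R m)).
have uM w m : w + t m *: A w = vecof e (rVof e w *m (1%:M + t m *: X)).
  rewrite mulmxDr mulmx1 linearD /= rVofK // -scalemxAr linearZ /=.
  by rewrite mul_mxof !rVofK.
(* Both sides are expressed in coordinates, where tangency is entrywise. *)
have gM w m (g : SL V) : val g = expEnd (t m *: A) ->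
    val g w = vecof e (rVof e w *m M (step R m)).
  by move=> gE; rewrite /M -gE mul_mxof !rVofK.
pose x w m := rVof e w *m M (step R m).
pose x' w m := rVof e w *m (1%:M + t m *: X).
have xx w k : tangent (fun m => t m) (fun m => x w m 0 k) (fun m => x' w m 0 k).
  by apply: tangent_mulmx => [m|i]; [exact: step_gt0|exact: MX].
have := tangent_dot_vecof h (@step_gt0 R) (xx u) (xx v).
apply: eq_tangent => m; last by rewrite /x' -!uM.
by have [g gE hg] := gA (step R m); rewrite /x -!(gM _ _ _ gE) hg.
Qed.

End OneParameter.

(** * Irreducible isotropic measures are stable *)

Section Stable.
Variables (R : realType) (V : vectType R[i]).
Hypothesis V0 : fullv != 0%VS :> {vspace V}.

(** By rigidity every element of the stabilizer is unitary for h', so the Lie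
    algebra of the stabilizer lies in su(h'), and an element of SL(V) that
    carries h' to a multiple of h conjugates it into su(h). *)
Lemma irreducible_stable (h h' : {dot V for Num.conj}) nu :
  irreducible nu -> isotropic h' nu -> stable h nu.
Proof.
move=> irr iso; split; first by apply/(polystable_isotropic _ _ V0); exists h'.
have [g [c [c0 hg]]] := dot_equiv h h'.
exists g => _ [A Anu <-]; have g0 := lker_SL g.
have [skew tr0] : su h' A.
  apply: (unitary_one_parameter_su V0) => s.
  by have [k kst kE] := Anu s; exists k => //; exact: stabilizer_unitary kst.
split.
  move=> u v; rewrite -{1}(lker0_lfunVK g0 v) -{2}(lker0_lfunVK g0 u) !comp_lfunE.
  by rewrite !hg skew mulrN.
rewrite -[LHS]/(endtr _) /Ad endtr_comp comp_lfunA lker0_compVf //.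
by rewrite comp_lfun1l.
Qed.

End Stable.

(** * Splitting a measure into irreducible pieces *)

Section Splitting.
Variables (R : realType) (V : vectType R[i]).
Implicit Types (nu : probability (projB V) R) (U : {vspace V}).

(** Irreducibility of the part of nu carried by P(U), expressed on the ambient
    projective space so that subspaces of subspaces do not occur. *)
Definition irreducible_on nu U := forall U1 U2,
  (U1 + U2 = U)%VS -> (U1 :&: U2 = 0)%VS ->
  almost_surely nu (fun L => subproj U L -> subproj U1 L \/ subproj U2 L) ->
  U1 = 0%VS \/ U2 = 0%VS.

(** As long as a piece splits, split it: the dimension drops. *)
Lemma irreducible_splitting nu U : U != 0%VS ->
  exists s : seq {vspace V},
    [/\ forall W, W \in s -> W != 0%VS,
        (\sum_(W <- s) W = U)%VS,
        (\sum_(W <- s) \dim W)%N = \dim U,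
        almost_surely nu (fun L => subproj U L ->
          exists2 W, W \in s & subproj W L) &
        forall W, W \in s -> irreducible_on nu W].
Proof.
have [n] := ubnP (\dim U); elim: n U => // n IH U; rewrite ltnS => Un U0.
have [irr|] := pselect (irreducible_on nu U).
  exists [:: U]; split.
  - by move=> W; rewrite inE => /eqP ->.
  - by rewrite big_seq1.
  - by rewrite big_seq1.
  - apply: (@almost_surelyS _ _ _ _ (fun=> True)); last first.
      by rewrite almost_surelyP ?setCT ?measure0 //; exact: measurableT.
    by move=> L _ LU; exists U; rewrite ?inE.
  - by move=> W; rewrite inE => /eqP ->.
move=> /existsNP[U1 /existsNP[U2 /not_implyP[U12 /not_implyP[U12d /not_implyP[ae]]]]].
move=> /not_orP[/eqP U1n /eqP U2n].
have dU : \dim U = (\dim U1 + \dim U2)%N by rewrite -U12 dimv_disjoint_sum.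
have [||s1 [s1n s1s s1d s1a s1i]] := IH U1.
- by apply: leq_trans Un; rewrite dU -addn1 leq_add2l lt0n dimv_eq0.
- exact: U1n.
have [||s2 [s2n s2s s2d s2a s2i]] := IH U2.
- by apply: leq_trans Un; rewrite dU -add1n leq_add2r lt0n dimv_eq0.
- exact: U2n.
exists (s1 ++ s2); split.
- by move=> W; rewrite mem_cat => /orP[/s1n|/s2n].
- by rewrite big_cat /= s1s s2s.
- by rewrite big_cat /= s1d s2d dU.
- apply: almost_surelyS (almost_surelyI ae (almost_surelyI s1a s2a)).
  move=> L [H [H1 H2]] /H [/H1|/H2] [W Ws LW]; exists W => //.
    by rewrite mem_cat Ws.
  by rewrite mem_cat Ws orbT.
- by move=> W; rewrite mem_cat => /orP[/s1i|/s2i].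
Qed.

Lemma splitting_projections r (W : 'I_r.+1 -> {vspace V}) :
    (\sum_j W j)%VS = fullv -> directv (\sum_j W j) ->
  exists pi : forall j, 'Hom(V, subvs_of (W j)),
    [/\ forall v, v = \sum_j vsval (pi j v),
        forall j (w : subvs_of (W j)), pi j (vsval w) = w &
        forall i j (w : subvs_of (W i)), i != j -> pi j (vsval w) = 0].
Proof.
move=> full dir.
pose p j := sumv_pi_for (esym full) j.
pose pi j : 'Hom(V, subvs_of (W j)) := (linfun (vsproj (W j)) \o p j)%VF.
have piE j v : vsval (pi j v) = p j v.
  by rewrite /pi comp_lfunE lfunE /= vsprojK // memv_sum_pi.
have psum v : v = \sum_j p j v by rewrite sumv_pi_sum ?memvf.
have pW i w : w \in W i -> forall j, p j w = if j == i then w else 0.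
  move=> wi j; pose q j := if j == i then w else 0.
  have w2 : w = \sum_j q j by rewrite -big_mkcond big_pred1_eq.
  have qW k : q k \in W k by rewrite /q; case: eqP => [->|_]; rewrite ?mem0v.
  have pW k : p k w \in W k by exact: memv_sum_pi.
  have /directv_sum_unique uniq := dir.
  have := uniq (p^~ w) q (fun k _ => pW k) (fun k _ => qW k).
  by rewrite -psum -w2 eqxx => /esym/forall_inP/(_ j isT)/eqP.
exists pi; split.
- by move=> v; under eq_bigr do rewrite piE; exact: psum.
- by move=> j w; apply: val_inj; rewrite /= piE (pW j) ?subvsP // eqxx.
- move=> i j w ij; apply: val_inj; rewrite /= piE (pW i) ?subvsP //.
  by rewrite eq_sym (negbTE ij).
Qed.

End Splitting.

(** * Measures carried by a direct sum *)

Section SplitMeasure.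
Variables (R : realType) (V : vectType R[i]) (r : nat).
Variables (W : 'I_r.+1 -> {vspace V}) (pi : forall j, 'Hom(V, subvs_of (W j))).
Hypothesis W0 : forall j, W j != 0%VS.
Hypothesis pi_sum : forall v, v = \sum_j vsval (pi j v).
Hypothesis pi_id : forall j (w : subvs_of (W j)), pi j (vsval w) = w.
Hypothesis pi_other : forall i j (w : subvs_of (W i)), i != j ->
  pi j (vsval w) = 0.

Local Notation incl j := (@proj_incl R V (W j)).
Local Notation iota j := (linfun (vsval : subvs_of (W j) -> V)).

Lemma ambient_neq0 : fullv != 0%VS :> {vspace V}.
Proof.
have := W0 ord0; apply: contra => /eqP f0.
by rewrite -subv0 -f0 subvf.
Qed.

Lemma dim_subvs j : \dim {: subvs_of (W j)} = \dim (W j).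
Proof. by rewrite dimvf. Qed.

Lemma subvs_neq0 j : fullv != 0%VS :> {vspace subvs_of (W j)}.
Proof. by rewrite -dimv_eq0 dim_subvs dimv_eq0. Qed.

Lemma incl_pline j (w : subvs_of (W j)) : w != 0 ->
  incl j (pline w) = pline (vsval w).
Proof. by move=> w0; rewrite /proj_incl projmap_pline // lfunE. Qed.

Lemma subproj_incl j (U : {vspace subvs_of (W j)}) (L : projB (subvs_of (W j))) :
  subproj (iota j @: U)%VS (incl j L) <-> subproj U L.
Proof.
have [z0 ->] := pline_surj L (subvs_neq0 j); set z := vpick _ in z0 *.
have iz0 : vsval z != 0 by apply: contra z0 => /eqP z0; apply/eqP/val_inj.
rewrite incl_pline // !subproj_pline //; split=> [/memv_imgP[w wU]|zU].
  by rewrite lfunE => /val_inj ->.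
by apply/memv_imgP; exists z; rewrite // lfunE.
Qed.

Lemma incl_subproj j (L : projB (subvs_of (W j))) : subproj (W j) (incl j L).
Proof.
have [z0 ->] := pline_surj L (subvs_neq0 j).
by rewrite incl_pline // subproj_pline // subvsP.
Qed.

Lemma incl_retract j (L : projB V) : subproj (W j) L ->
  incl j (projmap (pi j) L) = L.
Proof.
have [z0 ->] := pline_surj L ambient_neq0; set z := vpick _ in z0 *.
rewrite subproj_pline // => zW.
have piz : vsval (pi j z) = z by rewrite -{1}(vsprojK zW) pi_id vsprojK.
have piz0 : pi j z != 0 by apply: contra z0 => /eqP z0; rewrite -piz z0.
by rewrite projmap_pline // incl_pline // piz.
Qed.

Lemma subproj_disjoint i j (L : projB V) :
  subproj (W i) L -> subproj (W j) L -> i = j.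
Proof.
have [z0 ->] := pline_surj L ambient_neq0; set z := vpick _ in z0 *.
rewrite !subproj_pline // => zi zj; apply: contraTeq z0 => ij.
rewrite negbK; have := pi_other (vsproj (W i) z) ij; rewrite vsprojK // => pz.
by rewrite -(vsprojK zj) -(pi_id (vsproj (W j) z)) vsprojK // pz.
Qed.

(** On P(W j) the projection pi j is a retraction, so the restriction of nu to
    P(W j), normalized and pushed to P(W j), recovers that restriction. *)
Lemma split_measure (nu : probability (projB V) R) :
    almost_surely nu (fun L => exists j, subproj (W j) L) ->
  exists nu_ : forall j, probability (projB (subvs_of (W j))) R,
    forall A, measurable A -> nu A =
      (\sum_(j < r.+1) (fine (nu (subproj (W j))))%:E *
                        distribution (nu_ j) (incl j) A)%E.
Proof.
move=> nuW.
pose mP j := @measurable_subproj R V (W j).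
pose nu_ j : probability (projB (subvs_of (W j))) R :=
  distribution (mnormalize (mrestr nu (mP j)) nu) (projmapB (pi j)).
exists nu_ => A mA.
have nuf j : nu (subproj (W j)) \is a fin_num by rewrite fin_num_measure.
have E j : ((fine (nu (subproj (W j))))%:E * distribution (nu_ j) (incl j) A =
            nu (A `&` subproj (W j)))%E.
  rewrite fineK //.
  pose Q : set (projB V) := (projmapB (pi j)) @^-1` (incl j @^-1` A).
  have QE : Q `&` subproj (W j) = A `&` subproj (W j).
    apply/seteqP; split=> L [] /=; rewrite /Q /= /projmapB.
      by move=> + LW; rewrite incl_retract.
    by move=> LA LW; rewrite incl_retract.
  rewrite (_ : distribution _ _ A = mnormalize (mrestr nu (mP j)) nu Q) //.
  rewrite /mnormalize /= {1 2 3 4}/mrestr setTI.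
  have xE : nu (subproj (W j)) = (fine (nu (subproj (W j))))%:E by rewrite fineK.
  (* A piece of mass zero gets an arbitrary probability, with weight 0. *)
  case: ifPn => [|].
    rewrite [X in _ || X](_ : _ = false) ?orbF; last first.
      by apply/negP => /eqP nuoo; have := nuf j; rewrite nuoo.
    move=> /eqP nu0; rewrite nu0 mul0e; apply/esym.
    by apply: (subset_measure0 _ _ _ nu0) => //; exact: measurableI.
  rewrite negb_or => /andP[x0 _]; rewrite muleCA.
  rewrite QE [X in (_ * (X * _))%E]xE -EFinM divff ?mule1 //.
  by apply: contra x0 => /eqP x0; rewrite xE x0.
rewrite (eq_bigr _ (fun j _ => E j)) -measure_bigsetU_ord //; first last.
- move=> i j _ _ [L [[_ Li] [_ Lj]]]; exact: subproj_disjoint Li Lj.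
- by move=> j; apply: measurableI.
(* The union of the P(W j) has full measure, and the pieces are disjoint. *)
pose D := [set L | exists j, subproj (W j) L].
have DE : D = \big[setU/set0]_(j < r.+1) subproj (W j).
  rewrite -bigcup_mkord_ord; apply/seteqP; split=> L.
    by move=> [j Lj]; exists j => //=; rewrite inord_val.
  by move=> [j _ Lj]; exists (inord j).
have mD : measurable D by rewrite DE; exact: bigsetU_measurable.
have nD : nu (A `\` D) = 0%E.
  have nD := (almost_surelyP nu mD).1 nuW.
  by apply: (subset_measure0 _ _ _ nD); [exact: measurableD|exact: measurableC|].
rewrite (measureDI nu mA mD) [X in (X + _)%E]nD add0e; congr (nu _).
by rewrite DE big_distrr.
Qed.

(** Test the isotropy of nu on iota B pi, where B is an endomorphism of W j: only
    the lines in W j contribute, and the trace is that of B. The identity gives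
    the weight. *)
Lemma split_isotropic (nu : probability (projB V) R)
    (nu_ : forall j, probability (projB (subvs_of (W j))) R)
    (c : 'I_r.+1 -> R) (h : {dot V for Num.conj}) :
    (forall j, 0 <= c j) ->
    (forall A, measurable A -> nu A =
      (\sum_(j < r.+1) (c j)%:E * distribution (nu_ j) (incl j) A)%E) ->
    isotropic h nu -> forall j,
  c j = (\dim (W j))%:R / (\dim {:V})%:R /\
  isotropic (dot_pull h (lker_vsval (W j))) (nu_ j).
Proof.
move=> c0 nuE iso j.
have key (B : 'End(subvs_of (W j))) :
    c j * \int[nu_ j]_L rayleigh (dot_pull h (lker_vsval (W j))) B L =
    complex.Re (endtr B) / (\dim {:V})%:R.
  have := iso (iota j \o B \o pi j)%VF.
  rewrite (Rintegral_mixture c0 nuE); last exact: bounded_mfun_rayleigh.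
  have -> : endtr (iota j \o B \o pi j)%VF = endtr B.
    rewrite -comp_lfunA endtr_comp -comp_lfunA; congr endtr; apply/lfunP => w.
    by rewrite !comp_lfunE lfunE /= pi_id.
  move=> <-; rewrite (bigD1 j) //= big1 ?addr0 => [|i ij].
    rewrite Rintegral_distribution; last exact: bounded_mfun_rayleigh.
    congr (_ * _); apply: eq_Rintegral => L _; apply/esym.
    apply: rayleigh_pull; first exact: subvs_neq0.
    by move=> w; rewrite !comp_lfunE [linfun _ w]lfunE /= pi_id.
  rewrite Rintegral_distribution; last exact: bounded_mfun_rayleigh.
  have ray0 L : rayleigh h (iota j \o B \o pi j)%VF (incl i L) = 0.
    have [z0 ->] := pline_surj L (subvs_neq0 i); set z := vpick _ in z0 *.
    rewrite incl_pline // rayleigh_pline; last first.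
      by apply: contra z0 => /eqP z0; apply/eqP/val_inj.
    by rewrite !comp_lfunE pi_other // !linear0 linear0l mul0r.
  rewrite (@eq_Rintegral _ _ _ _ _ (fun=> 0)) => [|L _]; last exact: ray0.
  by rewrite Rintegral_cst // mul0r mulr0.
have cE : c j = (\dim (W j))%:R / (\dim {:V})%:R.
  have := key \1%VF; rewrite endtr1 dim_subvs.
  have ray1 L : rayleigh (dot_pull h (lker_vsval (W j))) \1%VF L = 1.
    have [z0 ->] := pline_surj L (subvs_neq0 j).
    by rewrite rayleigh_pline // id_lfunE divff ?dnorm_eq0.
  rewrite (@eq_Rintegral _ _ _ _ _ (fun=> 1)) => [|L _]; last exact: ray1.
  rewrite Rintegral_cst // [X in fine X](_ : _ = 1%E); last exact: probability_setT.
  by rewrite !mulr1 Re_nat.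
split=> // B; have := key B; rewrite cE dim_subvs.
have N0 : (\dim {:V})%:R != 0 :> R by rewrite pnatr_eq0 dimv_eq0 ambient_neq0.
have n0 : (\dim (W j))%:R != 0 :> R by rewrite pnatr_eq0 dimv_eq0.
move=> H; apply: (mulfI n0); apply: (mulIf (invr_neq0 N0)).
by rewrite mulrAC H [_%:R * (_ / _)]mulrC divfK.
Qed.

(** A splitting of W j that carries nu_ j is a splitting of the subspace of V that
    carries the part of nu on it. *)
Lemma split_irreducible (nu : probability (projB V) R)
    (nu_ : forall j, probability (projB (subvs_of (W j))) R)
    (c : 'I_r.+1 -> R) j :
    (forall A, measurable A -> nu A =
      (\sum_(j < r.+1) (c j)%:E * distribution (nu_ j) (incl j) A)%E) ->
  irreducible_on nu (W j) -> irreducible (nu_ j).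
Proof.
move=> nuE irr U1 U2 U12 U12d nujU.
have iK := lker_vsval (W j).
have i0 U : (iota j @: U = 0)%VS -> U = 0%VS.
  move=> iU; apply/eqP; rewrite -subv0; apply/subvP => u uU; rewrite memv0.
  have : iota j u \in (iota j @: U)%VS by exact: memv_img.
  by rewrite iU memv0 lfunE => /eqP u0; apply/eqP/val_inj.
have [|||/i0|/i0] := irr (iota j @: U1)%VS (iota j @: U2)%VS; [| | |by left|by right].
- rewrite -limgD U12; apply/vspaceP => v; apply/memv_imgP/idP => [[w _ ->]|vW].
    by rewrite lfunE subvsP.
  by exists (vsproj (W j) v); rewrite ?memvf // lfunE /= vsprojK.
- by rewrite -lker0_img_cap // U12d limg0.
have mU : measurable (subproj U1 `|` subproj U2).
  by apply: measurableU; exact: measurable_subproj.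
have nuj0 : nu_ j (~` (subproj U1 `|` subproj U2)) = 0%E.
  exact: (almost_surelyP (nu_ j) mU).1 nujU.
pose B : set (projB V) := ~` subproj (W j) `|`
  (subproj (iota j @: U1)%VS `|` subproj (iota j @: U2)%VS).
have mB : measurable B.
  apply: measurableU; first by apply: measurableC; exact: measurable_subproj.
  by apply: measurableU; exact: measurable_subproj.
have : almost_surely nu B.
  apply/(almost_surelyP nu mB); rewrite nuE ?big1 //; last exact: measurableC.
  move=> i _; apply/eqP; rewrite mule_eq0; apply/orP; right; apply/eqP.
  have [->|ij] := eqVneq i j.
    rewrite -nuj0; congr (nu_ j _); apply/seteqP; split=> L /=.
      by move=> /not_orP[_ /not_orP[]]; rewrite !subproj_incl => H1 H2 [].
    move=> /not_orP[H1 H2] [|]; first by move=> /(_ (incl_subproj _)).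
    by rewrite !subproj_incl => -[].
  rewrite -(measure0 (nu_ i)); congr (nu_ i _).
  apply/seteqP; split=> L //= nB; apply: nB; left => LW.
  by move/eqP: ij; apply; exact: subproj_disjoint (incl_subproj _) LW.
apply: almost_surelyS => L BL LW.
by case: BL => [/(_ LW)|].
Qed.

(** Make the summands orthogonal by adding up their Hermitian products. On a line
    of W j the Rayleigh quotient of B is that of its diagonal block, and the trace
    of B is the sum of those of its diagonal blocks. *)
Lemma glue_isotropic (nu : probability (projB V) R)
    (nu_ : forall j, probability (projB (subvs_of (W j))) R)
    (h_ : forall j, {dot subvs_of (W j) for Num.conj}) :
    (forall A, measurable A -> nu A =
      (\sum_(j < r.+1) ((\dim (W j))%:R / (\dim {:V})%:R)%:E *
         distribution (nu_ j) (incl j) A)%E) ->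
    (forall j, isotropic (h_ j) (nu_ j)) ->
  exists h : {dot V for Num.conj}, isotropic h nu.
Proof.
move=> nuE iso.
have pi_inj u : (forall j, pi j u = 0) -> u = 0.
  by move=> pu; rewrite [u]pi_sum big1 // => j _; rewrite pu.
exists (dot_sum h_ pi_inj) => B.
rewrite (Rintegral_mixture _ nuE); first last.
- exact: bounded_mfun_rayleigh.
- by move=> j; rewrite divr_ge0.
have BE : endtr B = \sum_j endtr (pi j \o B \o iota j)%VF.
  transitivity (endtr (\sum_j (B \o iota j \o pi j)%VF)).
    congr endtr; apply/lfunP => v; rewrite sum_lfunE {1}[v]pi_sum linear_sum.
    by apply: eq_bigr => j _; rewrite !comp_lfunE lfunE.
  rewrite linear_sum; apply: eq_bigr => j _.
  by rewrite -comp_lfunA [LHS]endtr_comp -!comp_lfunA endtr_comp -!comp_lfunA.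
rewrite BE Re_sum mulr_suml; apply: eq_bigr => j _.
rewrite Rintegral_distribution; last exact: bounded_mfun_rayleigh.
have rayE L : rayleigh (dot_sum h_ pi_inj) B (incl j L) =
    rayleigh (h_ j) (pi j \o B \o iota j)%VF L.
  have [z0 ->] := pline_surj L (subvs_neq0 j); set z := vpick _ in z0 *.
  have hz x : dot_sum h_ pi_inj x (vsval z) = h_ j (pi j x) z.
    rewrite /dot_sum (bigD1 j) //= pi_id big1 ?addr0 // => i ij.
    by rewrite pi_other 1?eq_sym // linear0r.
  rewrite incl_pline // !rayleigh_pline //.
  congr (complex.Re (_ / _)); apply: etrans (hz _) _.
    by rewrite !comp_lfunE [linfun _ z]lfunE.
  by rewrite pi_id.
have IE : \int[nu_ j]_L rayleigh (dot_sum h_ pi_inj) B (incl j L) =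
    \int[nu_ j]_L rayleigh (h_ j) (pi j \o B \o iota j)%VF L.
  by apply: eq_Rintegral => L _; exact: rayE.
have n0 : (\dim (W j))%:R != 0 :> R by rewrite pnatr_eq0 dimv_eq0.
by rewrite [X in _ * X]IE iso dim_subvs mulrC mulrA divfK.
Qed.

End SplitMeasure.

(** * The decomposition theorem *)

Section Decomposition.
Variables (R : realType) (V : vectType R[i]).
Hypothesis V0 : fullv != 0%VS :> {vspace V}.

Lemma isotropic_decomposition (h : {dot V for Num.conj})
    (nu : probability (projB V) R) : isotropic h nu ->
  exists (r : nat) (W : 'I_r.+1 -> {vspace V})
      (nu_ : forall j, probability (projB (subvs_of (W j))) R),
    [/\ (forall j, W j != 0%VS),
        (\sum_j W j)%VS = fullv,
        directv (\sum_j W j),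
        (forall j, irreducible (nu_ j) /\
           isotropic (dot_pull h (lker_vsval (W j))) (nu_ j)) &
        forall A, measurable A ->
          nu A = (\sum_(j < r.+1) ((\dim (W j))%:R / (\dim {:V})%:R)%:E *
                    distribution (nu_ j) (@proj_incl _ _ (W j)) A)%E].
Proof.
move=> iso; have [s [s0 sfull sdim snu sirr]] := irreducible_splitting nu V0.
case: s s0 sfull sdim snu sirr => [|W1 s'].
  by move=> _ V0'; move: V0; rewrite -V0' big_nil eqxx.
set s := W1 :: s' => s0 sfull sdim snu sirr.
pose W (j : 'I_(size s').+1) := nth 0%VS s j.
have Ws j : W j \in s by rewrite mem_nth.
have Wfull : (\sum_j W j)%VS = fullv by rewrite -sfull (big_nth 0%VS) big_mkord.
have Wdir : directv (\sum_j W j).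
  by rewrite directvE /= Wfull -sdim (big_nth 0%VS) big_mkord.
have W0 j : W j != 0%VS by exact/s0/Ws.
have [pi [pi_sum pi_id pi_other]] := splitting_projections Wfull Wdir.
have [|nu_ nuE] := split_measure W0 pi_id pi_other (nu := nu).
  apply: almost_surelyS snu => L /(_ (subvf _)) [_ /(nthP 0%VS) [k ks <-] LW].
  by exists (Ordinal ks).
have c0 j : 0 <= fine (nu (subproj (W j))) by exact: fine_ge0.
have split := split_isotropic W0 pi_id pi_other c0 nuE iso.
have cE j : fine (nu (subproj (W j))) = (\dim (W j))%:R / (\dim {:V})%:R.
  by case: (split j).
exists (size s'), W, nu_; split=> // [j|A mA].
  split; last by case: (split j).
  exact: (split_irreducible W0 pi_id pi_other nuE (sirr _ (Ws j))).
by rewrite nuE //; apply: eq_bigr => j _; rewrite cE.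
Qed.

Theorem polystable_decomposition (h : {dot V for Num.conj})
    (nu : probability (projB V) R) :
  polystable h nu <->
  exists (r : nat) (W : 'I_r.+1 -> {vspace V})
      (nu_ : forall j, probability (projB (subvs_of (W j))) R),
    [/\ (forall j, W j != 0%VS),
        (\sum_j W j)%VS = fullv,
        directv (\sum_j W j),
        (forall j, stable (@dot_restr _ _ (W j) h) (nu_ j)) &
        forall A, measurable A ->
          nu A = (\sum_(j < r.+1) ((\dim (W j))%:R / (\dim {:V})%:R)%:E *
                    distribution (nu_ j) (@proj_incl _ _ (W j)) A)%E].
Proof.
rewrite (polystable_isotropic _ _ V0); split.
  move=> [h' /isotropic_decomposition [r [W [nu_ [W0 Wfull Wdir Wiso nuE]]]]].
  exists r, W, nu_; split=> // j; have [irr iso] := Wiso j.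
  by apply: irreducible_stable irr iso; exact: subvs_neq0.
move=> [r [W [nu_ [W0 Wfull Wdir nuS nuE]]]].
have [pi [pi_sum pi_id pi_other]] := splitting_projections Wfull Wdir.
have isoj j : exists h : {dot subvs_of (W j) for Num.conj}, isotropic h (nu_ j).
  have [pol _] := nuS j.
  exact: ((polystable_isotropic _ _ (subvs_neq0 W0 j)).1 pol).
pose h_ j := projT1 (cid (isoj j)).
apply: (glue_isotropic W0 pi_sum pi_id pi_other nuE (h_ := h_)).
by move=> j; exact: projT2 (cid (isoj j)).
Qed.

End Decomposition.

Unset Implicit Arguments.

Theorem theorem7p8 (R : realType) (n : nat)
    (nu : probability (projB 'rV[R[i]]_n.+1) R) :
  polystable (@dotmx _ n.+1) nu <->
  exists (r : nat) (V : 'I_r.+1 -> {vspace 'rV[R[i]]_n.+1})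
      (nu_ : forall j, probability (projB (subvs_of (V j))) R),
    [/\ (forall j, V j != 0%VS),
        (\sum_j V j)%VS = fullv,
        directv (\sum_j V j),
        (forall j, stable (@dot_restr _ _ (V j) (@dotmx _ n.+1)) (nu_ j)) &
        forall A, measurable A ->
          nu A = (\sum_(j < r.+1) ((\dim (V j))%:R / n.+1%:R)%:E *
                    distribution (nu_ j) (@proj_incl _ _ (V j)) A)%E].
Proof.
have dimV : \dim {: 'rV[R[i]]_n.+1} = n.+1 by rewrite dimvf /dim /= mul1n.
have V0 : fullv != 0%VS :> {vspace 'rV[R[i]]_n.+1} by rewrite -dimv_eq0 dimV.
by have := polystable_decomposition V0 (@dotmx _ n.+1) nu; rewrite dimV.
Qed.
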